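(* There exists a natural number $k$ such that, if $G$ is a $k$-edge-connected graph and $|E(G)|$ is divisible by $5$, then $G$ admits a decomposition into paths of length $5$.
   Context: Graphs are simple (no loops or multiple edges). A decomposition into paths of length $5$ is a partition of $E(G)$ into edge sets of subgraphs each isomorphic to the path with $5$ edges. *)

(* Defs.v *)
(* Simple graph = symmetric irreflexive e : rel T on a finType T. *)
From mathcomp Require Import all_boot.
Set Implicit Arguments. Unset Strict Implicit. Unset Printing Implicit Defensive.

Definition edges (T : finType) (e : rel T) : {set {set T}} :=
  [set [set p.1; p.2] | p in [pred p : T * T | e p.1 p.2]].

Definition connected_edges (T : finType) (E : {set {set T}}) : Prop :=
  forall x y : T, connect [rel a b | [set a; b] \in E] x y.

Definition k_edge_connected (k : nat) (T : finType) (e : rel T) : Prop :=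
  forall F : {set {set T}}, F \subset edges e -> #|F| < k ->
    connected_edges (edges e :\: F).

Definition is_P5 (T : finType) (F : {set {set T}}) : Prop :=
  exists v : 'I_6 -> T, injective v /\
    F = [set [set v (widen_ord (leqnSn 5) i); v (lift ord0 i)] | i : 'I_5].

Definition P5_decomposable (T : finType) (e : rel T) : Prop :=
  exists P : {set {set {set T}}},
    partition P (edges e) /\ (forall F, F \in P -> is_P5 F).

(* Main.v *)
Require Import Defs.
From mathcomp Require Import all_boot zify.
Set Implicit Arguments. Unset Strict Implicit. Unset Printing Implicit Defensive.

(* Take a maximum cut A: its edges form a bipartite graph H that is still highly edge-connected.
   Inside the two sides, remove edge-disjoint paths of length 5 as long as possible; what is left
   is 4-degenerate, and each of its edges is completed to a path by four edges of H.
   H is packed with many edge-disjoint connected spanning subgraphs. Averaging them along Euler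
   tours gives two even connected subgraphs of small degree and a connected reserve. Each visit
   x y x' of an Euler tour becomes a path that starts with xy or with x'y and continues from y
   through four reserved edges; the choice between x and x' is a T-join problem, solved so that
   the remaining connected graph has an Euler trail. This trail is cut into trails of length 5.
   In a bipartite graph such a trail fails to be a path only if it closes a 4-cycle; then
   its end edge is exchanged with that of one of two special paths kept at every vertex. *)

(** * Packing edge-disjoint connected spanning subgraphs *)

(** Degrees in H are unbounded while the connectivity is a fixed constant, so whatever starts at a
    vertex may cost only a small fraction of its degree. This is why the connected subgraphs are
    averaged before use. All paths built apart from the Euler trail have five edges, so divisibility
    by 5 passes to the number of edges left for the trail. The ends x and x' of a visit lie on the
    same side of the cut, so one even subgraph corrects parities on one side only. Hence two are
    needed, with visits ending in A and outside A respectively. On each side one root vertex stays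
    uncontrolled. In the bipartite rest the degrees on either side sum to the number of edges, so
    the two roots are both even or both odd, and there is an Euler tour or an Euler trail between
    the roots. An exchange with a special path changes only its first vertex and keeps it distinct
    from the fifth, so special paths can be reused without limit. Two per vertex are needed because
    the new first vertex may be the fifth vertex of one of them. *)

Section Connectivity.
Variable T : finType.
Implicit Types (X Y Q C S : {set {set T}}) (x y u v : T).

Definition conn X := connect [rel a b : T | [set a; b] \in X].

Lemma conn0 X x : conn X x x.
Proof. exact: connect0. Qed.

Lemma conn_sym X x y : conn X x y = conn X y x.
Proof. by apply: sym_connect_sym => a b /=; rewrite setUC. Qed.

Lemma conn_trans X : transitive (conn X).
Proof. exact: connect_trans. Qed.

Lemma conn_edge X x y : [set x; y] \in X -> conn X x y.
Proof. by move=> h; apply: connect1. Qed.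

Lemma conn_sub X Y :
  (forall x y, [set x; y] \in X -> conn Y x y) -> forall x y, conn X x y -> conn Y x y.
Proof. by move=> h; apply: connect_sub. Qed.

Lemma conn_subset X Y x y : X \subset Y -> conn X x y -> conn Y x y.
Proof. by move=> /subsetP h; apply: conn_sub => a b /h; apply: conn_edge. Qed.

Lemma set2_eqP x y u v :
  [set x; y] = [set u; v] -> (x = u /\ y = v) \/ (x = v /\ y = u).
Proof.
move=> E.
have hx : x \in [set u; v] by rewrite -E set21.
have hy : y \in [set u; v] by rewrite -E set22.
have hu : u \in [set x; y] by rewrite E set21.
have hv : v \in [set x; y] by rewrite E set22.
move: hx hy hu hv; rewrite !inE.
move=> /orP[] /eqP -> /orP[] /eqP -> /orP[] /eqP ? /orP[] /eqP ?; subst; auto.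
Qed.

Lemma conn_addP X u v x y : conn (X :|: [set [set u; v]]) x y ->
  conn X x y \/ (conn X x u /\ conn X v y) \/ (conn X x v /\ conn X u y).
Proof.
case/connectP=> p; elim: p x => [|z p IH] x /=; first by move=> _ ->; left; apply: conn0.
case/andP=> hxz /IH h /h{h}.
have hz : conn X x z \/ (x = u /\ z = v) \/ (x = v /\ z = u).
  move: hxz; rewrite !inE => /orP[/conn_edge|/eqP/set2_eqP]; auto.
case: hz => [hz|[[-> ->]|[-> ->]]].
- case=> [h|[[h h']|[h h']]].
  + by left; apply: conn_trans hz h.
  + by right; left; split=> //; apply: conn_trans hz h.
  + by right; right; split=> //; apply: conn_trans hz h.
- case=> [h|[[h h']|[h h']]].
  + by right; left; split=> //; apply: conn0.
  + by right; left; split=> //; apply: conn0.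
  + by left.
- case=> [h|[[h h']|[h h']]].
  + by right; right; split=> //; apply: conn0.
  + by left.
  + by right; right; split=> //; apply: conn0.
Qed.

Lemma conn_delP X u v x y : conn X x y ->
  let X' := X :\ [set u; v] in
  conn X' x y \/ (conn X' x u /\ conn X' v y) \/ (conn X' x v /\ conn X' u y).
Proof.
move=> h /=; apply: conn_addP; apply: conn_subset h.
by rewrite setUC; apply/subsetP => E hE; rewrite !inE hE andbT orbN.
Qed.

(** A forest is encoded by the property that every edge is a bridge. Loops are excluded as well,
    since [conn] is reflexive. *)
Definition acyclic X := [forall x, forall y, ([set x; y] \in X) ==> ~~ conn (X :\ [set x; y]) x y].

Lemma acyclicP X :
  reflect (forall x y, [set x; y] \in X -> ~~ conn (X :\ [set x; y]) x y) (acyclic X).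
Proof.
apply: (iffP forallP) => [h x y|h x]; last by apply/forallP=> y; apply/implyP/h.
by move/forallP: (h x) => /(_ y) /implyP.
Qed.

Lemma acyclic_sub X Y : X \subset Y -> acyclic Y -> acyclic X.
Proof.
move=> sXY /acyclicP aY; apply/acyclicP=> x y hX; apply: contra (aY x y (subsetP sXY _ hX)).
by apply: conn_subset; apply: setSD.
Qed.

Lemma acyclic_add X u v :
  acyclic X -> ~~ conn X u v -> acyclic (X :|: [set [set u; v]]).
Proof.
move=> /acyclicP aX nuv; apply/acyclicP => x y.
have [/set2_eqP E _|ne] := eqVneq [set x; y] [set u; v].
  have sX: (X :|: [set [set u; v]]) :\ [set x; y] \subset X.
    have -> : [set x; y] = [set u; v] by case: E => [[-> ->]|[-> ->]] //; rewrite setUC.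
    by apply/subsetP=> E'; rewrite !inE => /andP[] /negPf ->; rewrite orbF.
  apply: contra nuv => /(conn_subset sX).
  by case: E => [[-> ->]|[-> ->]] //; rewrite conn_sym.
rewrite !inE (negPf ne) orbF => hX.
have E : (X :|: [set [set u; v]]) :\ [set x; y] = (X :\ [set x; y]) :|: [set [set u; v]].
  apply/setP=> Z; rewrite !inE; case: (eqVneq Z [set x; y]) => //= ->.
  by rewrite (negPf ne).
have nxy := aX _ _ hX.
rewrite E; apply/negP=> /conn_addP [h|h].
  by move: nxy; rewrite h.
have sub := conn_subset (subD1set X [set x; y]).
have cxy := conn_edge hX.
case: h => [[h1 h2]|[h1 h2]]; move: nuv => /negP; apply.
  rewrite conn_sym; apply: conn_trans (sub _ _ h2) _; rewrite conn_sym.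
  by rewrite conn_sym in h1; apply: conn_trans (sub _ _ h1) cxy.
rewrite conn_sym in h1.
apply: conn_trans (sub _ _ h2) _; rewrite conn_sym.
exact: conn_trans (sub _ _ h1) cxy.
Qed.


(** In a forest the path from u to v is unique, and an edge whose deletion keeps u and v joined lies
    off it. All such edges can therefore be deleted together. *)
Lemma acyclic_conn_del X S u v : acyclic X -> conn X u v ->
  {in S, forall E, exists x y, E = [set x; y]} -> S \subset X ->
  {in S, forall E, conn (X :\ E) u v} ->
  conn (X :\: S) u v.
Proof.
move=> /acyclicP aX cuv; move: {2}#|S| (leqnn #|S|) => n.
elim: n S => [|n IH] S.
  by rewrite leqn0 cards_eq0 => /eqP -> _ _ _; rewrite setD0.
move=> hn hp sS hS; have [->|[E hE]] := set_0Vmem S; first by rewrite setD0.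
have [x [y exy]] := hp _ hE.
have c1: conn (X :\: (S :\ E)) u v.
  apply: IH.
  - by move: hn; rewrite (cardsD1 E) hE.
  - by move=> F; rewrite !inE => /andP[_]; apply: hp.
  - by apply: subset_trans sS; apply: subD1set.
  - by move=> F; rewrite !inE => /andP[_]; apply: hS.
have ED: (X :\: (S :\ E)) :\ [set x; y] = X :\: S.
  rewrite -exy; apply/setP=> F; rewrite !inE; case: (eqVneq F E) => [->|] //=.
  by rewrite hE.
have := conn_delP x y c1; rewrite /= ED => -[//|h].
have h0 : conn (X :\ E) u v := hS _ hE.
have sD: X :\: S \subset X :\ E by rewrite setDS // sub1set.
have := aX x y; rewrite -exy => /(_ (subsetP sS _ hE)) /negP; case.
case: h => [[h1 h2]|[h1 h2]].
  move: (conn_subset sD h1) (conn_subset sD h2); rewrite conn_sym => h3 h4.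
  apply: conn_trans h3 _; rewrite conn_sym; apply: conn_trans h4 _.
  by rewrite conn_sym.
move: (conn_subset sD h1) (conn_subset sD h2); rewrite conn_sym => h3 h4.
rewrite conn_sym; apply: conn_trans h3 _; rewrite conn_sym.
by apply: conn_trans h4 _; rewrite conn_sym.
Qed.

Definition comps X : {set {set T}} := [set [set y | conn X x y] | x : T].

Lemma comps_eq X x y : ([set z | conn X x z] == [set z | conn X y z]) = conn X x y.
Proof.
apply/eqP/idP => [/setP /(_ y)|h]; first by rewrite !inE conn0.
apply/setP => z; rewrite !inE; apply/idP/idP; last exact: conn_trans h.
by rewrite conn_sym in h; apply: conn_trans h.
Qed.

Lemma card_comps_add X u v :
  ~~ conn X u v -> #|comps (X :|: [set [set u; v]])| < #|comps X|.
Proof.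
move=> nuv; set X' := _ :|: _.
have sX : X \subset X' by apply: subsetUl.
have cuv : conn X' u v by apply: conn_edge; rewrite !inE eqxx orbT.
pose g (C : {set T}) : {set T} := [set z | [exists x in C, conn X' x z]].
have gE x : g [set z | conn X x z] = [set z | conn X' x z].
  apply/setP => z; rewrite !inE; apply/existsP/idP => [[w]|h].
    by rewrite inE => /andP[/(conn_subset sX)]; apply: conn_trans.
  by exists x; rewrite inE conn0.
have -> : comps X' = g @: comps X.
  by rewrite /comps -imset_comp; apply: eq_imset => x /=; rewrite gE.
rewrite ltn_neqAle leq_imset_card andbT; apply/negP=> /imset_injP inj.
have h1 : [set z | conn X u z] \in comps X by apply: imset_f.
have h2 : [set z | conn X v z] \in comps X by apply: imset_f.
have := inj _ _ h1 h2; rewrite !gE => /(_ _) E.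
move: nuv; rewrite -(comps_eq X) => /eqP; apply; apply: E.
by apply/eqP; rewrite comps_eq.
Qed.

(** After the components of Q are contracted, C is a forest, so each of its edges lowers the number
    of components. *)
Lemma card_acyclic_mod Q C :
  {in C, forall E, exists x y, E = [set x; y]} ->
  (forall x y, [set x; y] \in C -> ~~ conn (Q :|: (C :\ [set x; y])) x y) ->
  #|C| + #|comps (Q :|: C)| <= #|comps Q|.
Proof.
move: {2}#|C| (leqnn #|C|) => n; elim: n C => [|n IH] C.
  by rewrite leqn0 cards_eq0 => /eqP -> _ _; rewrite cards0 setU0.
move=> hn hp hC; have [->|[E hE]] := set_0Vmem C; first by rewrite cards0 setU0.
have [x [y exy]] := hp _ hE.
have h : #|C :\ E| + #|comps (Q :|: C :\ E)| <= #|comps Q|.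
  apply: IH; first by move: hn; rewrite (cardsD1 E) hE.
- by move=> F; rewrite !inE => /andP[_]; apply: hp.
- move=> a b; rewrite !inE => /andP[hab habC]; apply: contra (hC _ _ habC).
  by apply: conn_subset; rewrite setUS // setSD // subD1set.
rewrite (cardsD1 E C) hE.
have := hC x y; rewrite -exy => /(_ hE) /card_comps_add; rewrite -exy.
have -> : Q :|: C :\ E :|: [set E] = Q :|: C by rewrite -setUA [_ :\ _ :|: _]setUC setD1K.
move=> h2; apply: leq_trans h; by rewrite -addnA add1n -addnS leq_add2l.
Qed.

End Connectivity.

Definition cut (T : finType) (X : {set {set T}}) (S : {set T}) : {set {set T}} :=
  [set E in X | (E :&: S != set0) && ~~ (E \subset S)].

Lemma double_count (I J : finType) (A : {set I}) (B : {set J}) (R : I -> J -> bool) :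
  \sum_(i in A) #|[set j in B | R i j]| = \sum_(j in B) #|[set i in A | R i j]|.
Proof.
have E (K : finType) (C : {set K}) (p : pred K) :
    #|[set k in C | p k]| = \sum_(k in C) p k.
  rewrite -sum1_card big_mkcond [RHS]big_mkcond; apply: eq_bigr => k _.
  by rewrite inE; case: (k \in C); case: (p k).
under eq_bigr do rewrite E; rewrite exchange_big.
by under [RHS]eq_bigr do rewrite E.
Qed.

(** * Maximum families of edge-disjoint forests *)

Section TreePacking.
Variables (T : finType) (H : {set {set T}}) (N : nat).
Hypothesis pairH : {in H, forall E, exists x y, E = [set x; y]}.

Local Notation coloring := {ffun {set T} -> option 'I_N}.
Implicit Types (c : coloring) (i j : 'I_N).

Definition cls c i : {set {set T}} := [set E in H | c E == Some i].
Definition forests c := [forall i, acyclic (cls c i)].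
Definition colored c := [set E in H | c E != None].
Definition recolor c u v x y i : coloring :=
  [ffun E => if E == [set u; v] then Some i else if E == [set x; y] then None else c E].
(** The uncolored edge uv takes the place of xy in forest i. That u and v are separated once xy is
    deleted means that xy lies on the cycle closed by uv, provided the forest joins u and v. This is
    the exchange step of matroid union. *)
Definition exchange : rel coloring := fun c c' =>
  [exists i, exists u, exists v, exists x, exists y,
     [&& [set u; v] \in H, c [set u; v] == None, [set x; y] \in cls c i,
         ~~ conn (cls c i :\ [set x; y]) u v & c' == recolor c u v x y i]].

Definition optimal c := forests c /\ forall c', forests c' -> #|colored c'| <= #|colored c|.

Lemma exchangeP c c' : reflect
  (exists i u v x y, [/\ [set u; v] \in H, c [set u; v] = None, [set x; y] \in cls c i,
     ~~ conn (cls c i :\ [set x; y]) u v & c' = recolor c u v x y i]) (exchange c c').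
Proof.
apply: (iffP existsP) => [[i /existsP[u /existsP[v /existsP[x /existsP[y]]]]]|].
  by case/and5P=> h1 /eqP h2 h3 h4 /eqP h5; exists i, u, v, x, y.
case=> i [u [v [x [y [h1 h2 h3 h4 h5]]]]]; exists i.
apply/existsP; exists u; apply/existsP; exists v; apply/existsP; exists x.
by apply/existsP; exists y; apply/and5P; split=> //; apply/eqP.
Qed.

(** Otherwise uv could be added to forest i, and one more edge would be colored. *)
Lemma optimal_conn c u v i :
  optimal c -> [set u; v] \in H -> c [set u; v] = None -> conn (cls c i) u v.
Proof.
case=> /forallP fc mc hH hN; apply/negPn/negP => nc.
pose c' : coloring := [ffun E => if E == [set u; v] then Some i else c E].
have ci : cls c' i = cls c i :|: [set [set u; v]].
  apply/setP=> E; rewrite !inE ffunE; case: (eqVneq E [set u; v]) => [->|_].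
    by rewrite hH eqxx orbT.
  by rewrite orbF.
have cj j : j != i -> cls c' j = cls c j.
  move=> nji.
  have nS : (Some i == Some j) = false by apply/eqP=> -[E']; rewrite E' eqxx in nji.
  apply/setP=> E; rewrite !inE ffunE; case: (eqVneq E [set u; v]) => [->|//].
  by rewrite hN nS.
have fc' : forests c'.
  apply/forallP=> j; have [->|nji] := eqVneq j i; last by rewrite cj.
  by rewrite ci; apply: acyclic_add.
have E : colored c' = [set u; v] |: colored c.
  apply/setP=> F; rewrite !inE ffunE; case: (eqVneq F [set u; v]) => [->|//].
  by rewrite hH.
have := mc _ fc'; rewrite E cardsU1 !inE hN eqxx andbF; lia.
Qed.

Lemma cls_recolor c u v x y i : [set u; v] \in H -> c [set u; v] = None ->
  [set x; y] \in cls c i ->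
  cls (recolor c u v x y i) i = (cls c i :\ [set x; y]) :|: [set [set u; v]].
Proof.
move=> hH hN hx; apply/setP=> E; rewrite !inE ffunE.
case: (eqVneq E [set u; v]) => [->|_]; first by rewrite hH eqxx orbT.
by rewrite orbF; case: (eqVneq E [set x; y]) => //=; rewrite andbF.
Qed.

Lemma cls_recolor_neq c u v x y i j : c [set u; v] = None ->
  [set x; y] \in cls c i -> j != i -> cls (recolor c u v x y i) j = cls c j.
Proof.
move=> hN; rewrite inE => /andP[_ /eqP hx] nji; apply/setP=> E; rewrite !inE ffunE.
have nS : (Some i == Some j) = false by apply/eqP=> -[E']; rewrite E' eqxx in nji.
have [->|_] := eqVneq E [set u; v].
  by rewrite hN nS.
have [->|//] := eqVneq E [set x; y].
by rewrite hx nS.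
Qed.

Lemma exchange_optimal c c' : optimal c -> exchange c c' -> optimal c'.
Proof.
move=> oc /exchangeP[i [u [v [x [y [hH hN hx nc ->]]]]]].
have [/forallP fc mc] := oc.
split.
  apply/forallP=> j; have [->|nji] := eqVneq j i; last by rewrite cls_recolor_neq.
  rewrite cls_recolor //; apply: acyclic_add => //.
  by apply: acyclic_sub (fc i); apply: subD1set.
move=> c'' /mc h; apply: leq_trans h _.
have -> : colored (recolor c u v x y i) = [set u; v] |: (colored c :\ [set x; y]).
  apply/setP=> F; rewrite !inE ffunE; case: (eqVneq F [set u; v]) => [->|_] //=.
    by rewrite hH.
  by case: (eqVneq F [set x; y]) => //=; rewrite andbF.
rewrite cardsU1 !inE hN eqxx !andbF.
have := cardsD1 [set x; y] (colored c).
by move: hx; rewrite !inE => /andP[-> /eqP ->] /= ->.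
Qed.

Variable c0 : coloring.
Hypothesis opt0 : optimal c0.

(* The edges left uncolored by some forest family reachable from c0 by exchanges. Within each
   color they span the same vertex classes, and the remaining edges are too few to cross
   between several classes of a highly edge-connected graph. *)
Definition freeable : {set {set T}} :=
  [set E in H | [exists c, connect exchange c0 c && (c E == None)]].
Local Notation Q := freeable.

Lemma reach_optimal c : connect exchange c0 c -> optimal c.
Proof.
case/connectP=> p; elim/last_ind: p c => [|p c' IH] c; first by move=> _ ->.
by rewrite rcons_path last_rcons => /andP[hp st] ->; apply: exchange_optimal st; apply: IH.
Qed.

(** Every edge on the path from u to v in forest i can be exchanged for uv, hence is freeable. The
    edges that are not freeable lie off this path and are deleted by [acyclic_conn_del]. *)
Lemma freeable_conn_cls c u v i : connect exchange c0 c ->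
  [set u; v] \in H -> c [set u; v] = None -> conn (cls c i :&: Q) u v.
Proof.
move=> rc hH hN; have oc := reach_optimal rc; have [/forallP fc _] := oc.
have cuv := optimal_conn i oc hH hN.
have -> : cls c i :&: Q = cls c i :\: (cls c i :\: Q).
  by rewrite setDDr setDv set0U.
have clsH E : E \in cls c i -> E \in H by rewrite inE => /andP[].
apply: acyclic_conn_del => //.
- by move=> E /setDP[/clsH hE _]; apply: pairH.
- exact: subsetDl.
move=> E /setDP[hE nQ]; apply: contraNT nQ => nc.
have [x [y exy]] := pairH (clsH _ hE).
rewrite inE (clsH _ hE) /=; apply/existsP; exists (recolor c u v x y i).
apply/andP; split; last first.
  rewrite ffunE -exy eqxx; have [E'|//] := eqVneq E [set u; v].
  by move: hE; rewrite inE E' hN andbF.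
apply: connect_trans rc (connect1 _); apply/exchangeP.
by exists i, u, v, x, y; rewrite -exy; split.
Qed.

(** The two classes differ in uv and xy only. Each of these edges is uncolored on one side of the
    exchange, so [freeable_conn_cls], applied to c and to c', joins its ends by freeable edges. *)
Lemma exchange_span c c' i : connect exchange c0 c -> exchange c c' ->
  conn (cls c' i :&: Q) =2 conn (cls c i :&: Q).
Proof.
move=> rc st; have rc' := connect_trans rc (connect1 st).
case/exchangeP: st => j [u [v [x [y [hH hN hx nc e']]]]].
have [eij|nij] := eqVneq i j; last by rewrite e' cls_recolor_neq.
subst j.
have hxH : [set x; y] \in H by move: hx; rewrite inE => /andP[].
have ncE: [set x; y] == [set u; v] = false.
  by apply/eqP=> E; move: hx; rewrite inE E hN andbF.
have h1 := freeable_conn_cls i rc hH hN.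
have hN' : c' [set x; y] = None by rewrite e' ffunE eqxx ncE.
have h2 := freeable_conn_cls i rc' hxH hN'.
have ec : cls c' i = cls c i :\ [set x; y] :|: [set [set u; v]] by rewrite e' cls_recolor.
move=> a b; apply/idP/idP; apply: conn_sub => {}a {}b.
  rewrite in_setI ec in_setU in_set1 => /andP[/orP[]].
    by rewrite in_setD1 => /andP[_ ha] hb; apply: conn_edge; rewrite in_setI ha.
  move=> /eqP/set2_eqP[[-> ->]|[-> ->]] _ //.
  by rewrite conn_sym.
rewrite in_setI => /andP[hab hQ].
have [/set2_eqP[[-> ->]|[-> ->]]|ne] := eqVneq [set a; b] [set x; y].
- exact: h2.
- by rewrite conn_sym.
by apply: conn_edge; rewrite in_setI hQ ec in_setU in_setD1 hab ne.
Qed.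

Lemma reach_span c i : connect exchange c0 c ->
  conn (cls c i :&: Q) =2 conn (cls c0 i :&: Q).
Proof.
case/connectP=> p; elim/last_ind: p c => [|p c' IH] c; first by move=> _ ->.
rewrite rcons_path last_rcons => /andP[hp st] -> a b.
rewrite (exchange_span i _ st) ?IH //; first by apply/connectP; exists p.
Qed.

Lemma freeable_span i x y : conn Q x y -> conn (cls c0 i :&: Q) x y.
Proof.
apply: conn_sub => {}x {}y; rewrite inE => /andP[hH /existsP[c /andP[rc /eqP hN]]].
by rewrite -(reach_span i rc); apply: freeable_conn_cls.
Qed.

Definition crossings := [set E in H | [forall x, forall y, (E == [set x; y]) ==> ~~ conn Q x y]].

Lemma crossingsP x y : [set x; y] \in crossings -> ~~ conn Q x y.
Proof. by rewrite inE => /andP[_ /forallP/(_ x)/forallP/(_ y)]; rewrite eqxx. Qed.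

(** The freeable edges of color i already connect each component of Q. Since the whole class is a
    forest, its crossing edges form a forest on the contracted components. *)
Lemma card_crossings_cls i : 0 < #|T| -> #|crossings :&: cls c0 i| < #|comps Q|.
Proof.
case/card_gt0P=> x0 _; set C := _ :&: _.
have cp : 0 < #|comps (Q :|: C)|.
  by apply/card_gt0P; exists [set z | conn (Q :|: C) x0 z]; apply: imset_f.
suff : #|C| + #|comps (Q :|: C)| <= #|comps Q| by lia.
apply: card_acyclic_mod => [E|x y].
  by rewrite !inE => /andP[/andP[hE _] _]; apply: pairH.
case/setIP=> /crossingsP nc hxy.
have /acyclicP aC : acyclic (cls c0 i) by case: opt0 => /forallP.
apply: contra (aC _ _ hxy); apply: conn_sub => a b /setUP[hab|].
  apply: (@conn_subset T (cls c0 i :&: Q)); last exact/freeable_span/conn_edge.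
  apply/subsetP=> E /setIP[hE hQ]; rewrite in_setD1 hE andbT.
  by apply: contraNneq nc => E'; apply: conn_edge; rewrite -E'.
case/setD1P=> hne /setIP[_ hc]; apply: conn_edge.
by rewrite in_setD1 hne.
Qed.

Lemma crossings_colored E : E \in crossings -> exists i, E \in cls c0 i.
Proof.
move=> hE; have hH : E \in H by move: hE; rewrite inE => /andP[].
case ce : (c0 E) => [i|]; first by exists i; rewrite inE hH ce eqxx.
have [x [y exy]] := pairH hH; rewrite exy in hE hH ce.
have /negP := crossingsP hE; case; apply: conn_edge; rewrite inE hH.
by apply/existsP; exists c0; rewrite connect0 ce.
Qed.

Lemma card_crossings : 0 < #|T| -> #|crossings| <= N * (#|comps Q|.-1).
Proof.
move=> T0; rewrite -[X in X * _]card_ord -sum_nat_const.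
apply: (@leq_trans (\sum_(i in [set: 'I_N]) #|[set E in crossings | E \in cls c0 i]|)).
  rewrite double_count -sum1_card; apply: leq_sum => E /crossings_colored[i hi].
  by apply/card_gt0P; exists i; rewrite inE hi inE.
rewrite (eq_bigl xpredT) => [|i]; last by rewrite inE.
apply: leq_sum => i _; have := card_crossings_cls i T0.
have -> : [set E in crossings | E \in cls c0 i] = crossings :&: cls c0 i.
  by apply/setP=> E; rewrite !inE.
by case: #|comps Q|.
Qed.

(** With p > 1 components, each is left by at least K crossing edges and each crossing edge is
    counted at most twice, so K p <= 2 N (p - 1). This contradicts 2 N <= K. *)
Lemma freeable_connected K : 0 < N -> 2 * N <= K ->
  (forall S, S != set0 -> S != setT -> K <= #|cut H S|) -> forall x y, conn Q x y.
Proof.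
move=> N0 NK hcut x0 y0; apply/negPn/negP=> nc.
have T0 : 0 < #|T| by apply/card_gt0P; exists x0.
have p2 : 1 < #|comps Q|.
  apply/card_gt1P; exists [set z | conn Q x0 z], [set z | conn Q y0 z].
  by rewrite !imset_f // comps_eq.
have h1 : K * #|comps Q| <= \sum_(S in comps Q)
    #|[set E in crossings | (E :&: S != set0) && ~~ (E \subset S)]|.
  rewrite mulnC -sum_nat_const; apply: leq_sum => S /imsetP[x _ eS].
  apply: (@leq_trans #|cut H S|).
    apply: hcut; first by apply/set0Pn; exists x; rewrite eS inE conn0.
    apply: contra nc => /eqP ST.
    have := in_setT x0; have := in_setT y0; rewrite -ST eS !inE => hy hx.
    by rewrite conn_sym in hx; apply: conn_trans hx hy.
  apply/subset_leq_card/subsetP=> E; rewrite !inE => /and3P[hH h2 h3].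
  rewrite hH h2 h3 !andbT; apply/forallP=> a; apply/forallP=> b; apply/implyP=> /eqP eE.
  apply/negP=> cab; case/set0Pn: h2 => z; rewrite inE eE !inE => /andP[hz].
  move: h3; rewrite eE subUset !sub1set eS !inE => /negP h3 hx; apply: h3.
  by case/orP: hz => /eqP hz; subst z; rewrite hx; [|rewrite andbT];
    apply: conn_trans hx _ => //; rewrite conn_sym.
have h2 : \sum_(S in comps Q) #|[set E in crossings | (E :&: S != set0) && ~~ (E \subset S)]|
    <= 2 * #|crossings|.
  rewrite double_count mulnC -sum_nat_const; apply: leq_sum => E hE.
  have hH : E \in H by move: hE; rewrite inE => /andP[].
  have [a [b eE]] := pairH hH.
  apply: (@leq_trans #|[set [set z | conn Q a z]; [set z | conn Q b z]]|); last first.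
    by rewrite cards2; case: (_ != _).
  apply/subset_leq_card/subsetP=> S; rewrite 3!inE => /andP[/imsetP[x _ eS] /andP[]].
  case/set0Pn=> z; rewrite in_setI eE eS in_set2 inE => /andP[hz hx] _.
  by case/orP: hz => /eqP hz; subst z; rewrite in_set1 !comps_eq hx ?orbT.
have h3 := card_crossings T0.
move: N0 NK p2 h1 h2 h3; clear; move: #|_| (\sum_(_ in _) _) #|crossings| => p s r.
case: p => [//|p] /=; move=> N0 NK _ h1 h2 h3.
have : 2 * N * p.+1 <= 2 * (N * p).
  by apply: leq_trans (leq_mul NK (leqnn _)) _; lia.
by rewrite mulnS; lia.
Qed.

End TreePacking.

(** A weak form of the Nash-Williams and Tutte theorem: each color class of a maximum family of
    forests connects all vertices, because the freeable edges do. *)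
Theorem tree_packing (T : finType) (H : {set {set T}}) N K :
  {in H, forall E, exists x y, E = [set x; y]} -> 2 * N <= K ->
  (forall S, S != set0 -> S != setT -> K <= #|cut H S|) ->
  exists c : {set T} -> nat, forall i, i < N -> connected_edges [set E in H | c E == i].
Proof.
move=> pairH NK hcut.
pose cN : {ffun {set T} -> option 'I_N} := [ffun=> None].
have fN : forests H cN.
  by apply/forallP=> i; apply/acyclicP=> x y; rewrite inE ffunE andbF.
case: (@arg_maxnP _ cN (@forests T H N) (fun c => #|colored H c|) fN) => c0 f0 m0.
have opt0 : optimal H c0 by split.
case: (posnP N) => [->|N0]; first by exists (fun=> 0).
(* Uncolored edges receive the value N, which lies outside the range of colors. *)
exists (fun E => if c0 E is Some i then val i else N) => i iN x y.
have h := freeable_span pairH opt0 (Ordinal iN) (freeable_connected pairH opt0 N0 NK hcut x y).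
apply: conn_subset h; apply/subsetP=> E; rewrite !inE => /andP[/andP[-> /eqP ->] _] /=.
by rewrite eqxx.
Qed.

(** * Parity joins and Euler trails *)

Section ParityJoin.
Variables (I T : finType) (toggle : I -> T -> bool) (X : {set I}).

Definition parity (s : I -> bool) v := \big[addb/false]_i (s i && toggle i v).

(** An index i acts as an edge ab of an abstract multigraph when switching it flips exactly a and b
    modulo 2. Both genuine edges and binary choices at visits are instances. *)
Definition toggles : rel T :=
  fun a b => [exists i in X, [forall v, toggle i v == (v == a) (+) (v == b)]].

Lemma toggle_path x y : connect toggles x y ->
  exists s : I -> bool, (forall i, s i -> i \in X) /\
    forall v, parity s v = (v == x) (+) (v == y).
Proof.
case/connectP=> p; elim: p x => [|z p IH] x /=.
  move=> _ ->; exists (fun=> false); split=> // v.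
  by rewrite /parity big1 // addbb.
case/andP=> /existsP[i /andP[iX /forallP hi]] /IH h /h{h} [s [sX hs]].
exists (fun j => s j (+) (j == i)); split=> [j|v].
  by case: eqP => [-> //|_]; rewrite addbF; apply: sX.
rewrite /parity; under eq_bigr do rewrite andb_addl.
rewrite big_split /= [X in X (+) _]hs.
rewrite (bigD1 i) //= eqxx (eqP (hi v)) big1 ?addbF /=; last by move=> j /negPf ->.
by case: (v == x); case: (v == z); case: (v == y).
Qed.

(** Superpose modulo 2 one path from x to [root x] for every x with t x. Away from the roots only
    the starting points count. A root function instead of a single root handles several components
    at once. *)
Lemma parity_join (root : T -> T) (t : T -> bool) :
  (forall x, connect toggles x (root x)) ->
  exists s : I -> bool, (forall i, s i -> i \in X) /\
    forall v, (forall x, root x != v) -> parity s v = t v.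
Proof.
move=> h; have /fin_all_exists[sx hsx] := fun x => toggle_path (h x).
exists (fun i => \big[addb/false]_x (t x && sx x i)); split=> [i|v hv].
  apply: contraTT => iX; rewrite big1 // => x _.
  by case: (boolP (sx x i)) => [/(proj1 (hsx x)) ii|_]; [rewrite ii in iX | rewrite andbF].
rewrite /parity; under eq_bigr do rewrite big_distrl /=.
rewrite exchange_big /=.
rewrite (eq_bigr (fun x => t x && (v == x))) => [|x _].
  rewrite (bigD1 v) //= eqxx andbT big1 ?addbF // => x /negPf.
  by rewrite eq_sym => ->; rewrite andbF.
under eq_bigr do rewrite -andbA.
rewrite -big_distrr /= -/(parity _ _) (proj2 (hsx x)).
by rewrite [v == root x]eq_sym (negPf (hv x)) addbF.
Qed.

End ParityJoin.

Section Degrees.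
Variable T : finType.
Implicit Types (X Y Z : {set {set T}}) (x y v : T) (p : seq T).

Definition deg X v := #|[set E in X | v \in E]|.

Definition simple X := [forall E in X, #|E| == 2].

Lemma simpleP X : simple X -> {in X, forall E, exists x y, x != y /\ E = [set x; y]}.
Proof.
by move=> /forallP sX E EX; move: (sX E); rewrite EX => /cards2P[x [y [nxy ->]]]; exists x, y.
Qed.

Lemma simple_neq X x y : simple X -> [set x; y] \in X -> x != y.
Proof.
by move=> /forallP sX xy; move: (sX [set x; y]); rewrite xy cards2; case: (x != y).
Qed.

Lemma simple_sub X Y : X \subset Y -> simple Y -> simple X.
Proof.
move=> /subsetP sXY /forallP sY; apply/forallP => E; apply/implyP => /sXY EY.
by move: (sY E); rewrite EY.
Qed.

Lemma odd_card (I : finType) (A : {set I}) (q : pred I) :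
  odd #|[set i in A | q i]| = \big[addb/false]_(i in A) q i.
Proof.
rewrite -sum1_card (big_morph odd oddD (erefl (odd 0))) [LHS]big_mkcond [RHS]big_mkcond.
by apply: eq_bigr => i _; rewrite inE; case: (i \in A) => //; case: (q i).
Qed.

Lemma deg_sub X Y v : X \subset Y -> deg X v <= deg Y v.
Proof.
by move=> /subsetP s; apply/subset_leq_card/subsetP => E; rewrite !inE => /andP[/s -> ->].
Qed.

Lemma deg_disjointU X Y v : [disjoint X & Y] -> deg (X :|: Y) v = deg X v + deg Y v.
Proof.
move=> dXY; rewrite /deg -cardsUI [X in _ = _ + X]eq_card0 ?addn0.
  by apply: eq_card => E; rewrite !inE andb_orl.
by move=> E; rewrite !inE; case EX: (E \in X) => //; rewrite (disjointFr dXY EX) andbF.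
Qed.

Lemma deg_setD X Y v : Y \subset X -> deg X v = deg Y v + deg (X :\: Y) v.
Proof.
move=> sYX; rewrite -deg_disjointU; last first.
  by rewrite -setI_eq0; apply/eqP/setP=> E; rewrite !inE; case: (E \in Y).
by rewrite -{1}(setID X Y) (setIidPr sYX).
Qed.

Lemma handshake X : simple X -> \sum_(v : T) deg X v = 2 * #|X|.
Proof.
move=> sX; rewrite (eq_bigl (fun v => v \in [set: T])) => [|v]; last by rewrite inE.
rewrite (double_count setT X (fun v (E : {set T}) => v \in E)) mulnC -sum_nat_const.
apply: eq_bigr => E EX.
have /eqP <- : #|E| == 2 by move/forallP: sX => /(_ E); rewrite EX.
by apply: eq_card => v; rewrite !inE.
Qed.

Lemma conn_exit X (S : pred T) x y : conn X x y -> S x -> ~~ S y ->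
  exists u z, [/\ S u, ~~ S z & [set u; z] \in X].
Proof.
case/connectP=> p; elim: p x => [|z p IH] x /=; first by move=> _ -> ->.
case/andP=> xz hp e Sx nSy; have [Sz|nSz] := boolP (S z).
  exact: IH hp e Sz nSy.
by exists x, z.
Qed.

(** A join chosen in Y corrects the parity of X at every vertex but r, and the handshake identity
    settles r. *)
Lemma even_connected X Y : simple X -> simple Y -> [disjoint X & Y] ->
  connected_edges X -> connected_edges Y ->
  exists Z, [/\ X \subset Z, Z \subset X :|: Y, connected_edges Z & forall v, ~~ odd (deg Z v)].
Proof.
move=> sX sY dXY cX cY.
have [T0|/card_gt0P[r _]] := posnP #|T|.
  exists X; split=> //; first exact: subsetUl.
  by move=> v; have := card0_eq T0 v; rewrite inE.
have [s [sY' hs]] : exists s : {set T} -> bool, (forall E, s E -> E \in Y) /\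
    forall v, (forall x : T, r != v) ->
      parity (fun (E : {set T}) v => v \in E) s v = odd (deg X v).
  apply: (@parity_join _ _ _ Y (fun=> r)) => x.
  apply: connect_sub (cY x r) => a b /= ab; apply: connect1.
  apply/existsP; exists [set a; b]; rewrite ab; apply/forallP=> v.
  have := simple_neq sY ab; rewrite !inE.
  by case: (eqVneq v a) => [->|] //; case: (eqVneq a b).
pose J := [set E in Y | s E].
have sJ : J \subset Y by apply/subsetP=> E; rewrite inE => /andP[].
have dXJ : [disjoint X & J] by rewrite disjoint_sym (disjointWl sJ) // disjoint_sym.
have sZ : simple (X :|: J).
  apply/forallP=> E; apply/implyP=> /setUP[EX|/(subsetP sJ) EY].
    by move/forallP: sX => /(_ E); rewrite EX.
  by move/forallP: sY => /(_ E); rewrite EY.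
have ev v : v != r -> ~~ odd (deg (X :|: J) v).
  move=> nvr; rewrite deg_disjointU // oddD -hs; last by move=> _; rewrite eq_sym.
  rewrite /parity /deg odd_card [X in _ (+) X]big_mkcond /= -big_split big1 // => E _.
  by rewrite /= inE; case: (boolP (s E)) => [/sY' ->|_]; rewrite ?andbF //= addbb.
exists (X :|: J); split; [exact: subsetUl | exact: setUS | |].
  by move=> x y; apply: (conn_subset (subsetUl _ _)) (cX x y).
move=> v; have [->|/ev//] := eqVneq v r.
have := congr1 odd (handshake sZ); rewrite oddM /= (bigD1 r) //= oddD.
rewrite (big_morph odd oddD (erefl (odd 0))) [X in _ (+) X]big1 ?addbF => [|u /ev/negPf //].
by move=> ->.
Qed.

Definition tedges x p : seq {set T} := pairmap (fun a b => [set a; b]) x p.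

Lemma tedges_cat x p q : tedges x (p ++ q) = tedges x p ++ tedges (last x p) q.
Proof. exact: pairmap_cat. Qed.

Lemma size_tedges x p : size (tedges x p) = size p.
Proof. exact: size_pairmap. Qed.

Definition trail X x p := all (mem X) (tedges x p) && uniq (tedges x p).

Lemma tedges_vertices x p E v : E \in tedges x p -> v \in E -> v \in x :: p.
Proof.
elim: p x => [|z p IH] x //=; rewrite inE => /orP[/eqP ->|h1 h2].
  by rewrite !inE => /orP[] ->; rewrite ?orbT.
by have := IH _ h1 h2; rewrite !inE => ->; rewrite orbT.
Qed.

Lemma trail_size X x p : trail X x p -> size p <= #|X|.
Proof.
case/andP=> /allP h u; rewrite -(size_tedges x) cardE; apply: uniq_leq_size => // E /h.
by rewrite mem_enum.
Qed.

Lemma odd_deg_trail X x p v : simple X -> trail X x p ->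
  odd (deg [set E in tedges x p] v) = (v == x) (+) (v == last x p).
Proof.
move=> sX; elim: p x => [|z p IH] x /=.
  by rewrite addbb /deg eq_card0 // => E; rewrite !inE.
rewrite /trail /= => /andP[/andP[xz ap] /andP[nu up]].
have nxz := simple_neq sX xz.
have -> : [set E in [set x; z] :: tedges z p] = [set [set x; z]] :|: [set E in tedges z p].
  by apply/setP=> E; rewrite !inE.
rewrite deg_disjointU; last by rewrite disjoints1 inE.
rewrite oddD IH ?/trail ?ap //.
have -> : odd (deg [set [set x; z]] v) = (v == x) (+) (v == z).
  rewrite /deg odd_card big_set1 !inE.
  by case: (eqVneq v x) => [->|] //; case: (eqVneq x z) nxz.
by rewrite addbA addbK.
Qed.



Lemma trail_rcons X x y p : simple X ->
  (forall v, odd (deg X v) = (v == x) (+) (v == y)) -> trail X x p ->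
  last x p != y -> exists z, trail X x (rcons p z).
Proof.
move=> sX par tp ne.
have [E EX nE] : exists2 E, E \in [set E in X | last x p \in E] & E \notin [set E in tedges x p].
  apply/subsetPn/negP=> sub; have := par (last x p); have := odd_deg_trail (last x p) sX tp.
  have -> : deg [set E in tedges x p] (last x p) = deg X (last x p).
    apply: eq_card => E; rewrite !inE; apply/andP/andP => -[hE lE]; split=> //.
      by case/andP: tp => /allP/(_ _ hE).
    by have := subsetP sub E; rewrite !inE hE lE => /(_ isT).
  by move=> ->; rewrite eqxx (negPf ne); case: (_ == _).
move: EX nE; rewrite !inE => /andP[EX lE] nE.
have [a [b [nab eE]]] := simpleP sX EX.
have [z ez] : exists z, E = [set last x p; z].
  by move: lE; rewrite eE !inE => /orP[/eqP ->|/eqP ->]; [exists b|exists a; rewrite setUC].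
case/andP: tp => ap up.
exists z; rewrite /trail -cats1 tedges_cat /= all_cat cat_uniq /= -ez EX up ap.
by rewrite orbF nE.
Qed.

Lemma trail_complete X x y p : simple X ->
  (forall v, odd (deg X v) = (v == x) (+) (v == y)) -> trail X x p ->
  exists q, [/\ trail X x q, last x q = y & size p <= size q].
Proof.
move=> sX par; move: {2}(#|X| - size p) (leqnn (#|X| - size p)) => n.
elim: n p => [|n IH] p hn tp; have [h|ne] := eqVneq (last x p) y; try by exists p.
  have [z /trail_size] := trail_rcons sX par tp ne.
  by rewrite size_rcons; lia.
have [z lz] := trail_rcons sX par tp ne.
have [|q [tq lq sq]] := IH _ _ lz; first by have := trail_size lz; rewrite size_rcons; lia.
by exists q; split=> //; move: sq; rewrite size_rcons; lia.
Qed.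

Lemma trail_splice X x y p : simple X -> connected_edges X ->
  (forall v, odd (deg X v) = (v == x) (+) (v == y)) ->
  trail X x p -> last x p = y -> ~~ (X \subset [set E in tedges x p]) ->
  exists q, [/\ trail X x q, last x q = y & size p < size q].
Proof.
move=> sX cX par tp lp /subsetPn[E EX]; rewrite inE => nE.
have [ap up] := andP tp.
pose X' := X :\: [set E in tedges x p].
have sX' : simple X' by apply: simple_sub (subsetDl _ _) sX.
have sub : [set E in tedges x p] \subset X by apply/subsetP=> F; rewrite inE => /(allP ap).
have par' w v : odd (deg X' v) = (v == w) (+) (v == w).
  have := congr1 odd (deg_setD v sub); rewrite oddD par (odd_deg_trail v sX tp) lp addbb.
  by rewrite -/X'; case: (odd (deg X' v)); case: (_ (+) _).
have [w [z [wp wz]]] : exists w z, w \in x :: p /\ [set w; z] \in X'.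
  have [a [b [nab eE]]] := simpleP sX EX.
  have [ha|ha] := boolP (a \in x :: p).
    by exists a, b; split=> //; rewrite -eE in_setD inE nE EX.
  have [u [z [hu hz uz]]] := conn_exit (S := mem (x :: p)) (cX x a) (mem_head _ _) ha.
  exists u, z; split=> //; rewrite in_setD uz inE andbT.
  by apply: contra hz => /tedges_vertices; apply; rewrite set22.
have twz : trail X' w [:: z] by rewrite /trail /= wz.
(* Extending the one-step trail wz makes the closed trail nonempty, so the spliced trail is strictly
   longer. *)
have [q [/andP[aq uq] lq sq]] := trail_complete sX' (par' w) twz.
case/splitPl: wp lp tp ap up @X' sX' sub par' wz twz aq uq nE => p1 p2 lw.
rewrite last_cat lw => lp tp ap up X' sX' sub par' wz twz aq uq nE.
exists (p1 ++ q ++ p2); rewrite !last_cat lw lq lp !size_cat; split=> //; last first.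
  by move: sq => /=; lia.
move: ap up sub @X' sX' par' wz twz aq uq; rewrite /trail !tedges_cat lw lq !all_cat !cat_uniq.
case/andP=> -> -> /and3P[-> h ->] sub sX' par' wz twz aq uq; rewrite uq has_cat negb_or h !andbT /=.
have nq F : F \in tedges w q -> F \notin tedges x p1 ++ tedges w p2.
  by move=> /(allP aq) /=; rewrite in_setD inE => /andP[].
apply/and3P; split.
- by apply/allP=> F /(allP aq) /=; rewrite in_setD => /andP[].
- apply/hasPn=> F /nq.
  by rewrite mem_cat negb_or => /andP[].
apply/hasPn=> F h2; apply/negP=> /nq; rewrite mem_cat h2 orbT.
by [].
Qed.

(** For x = y the parity condition says that all degrees are even, so tours and open trails are
    covered together. *)
Lemma euler_trail X x y : simple X -> connected_edges X ->
  (forall v, odd (deg X v) = (v == x) (+) (v == y)) ->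
  exists p, last x p = y /\ perm_eq (tedges x p) (enum X).
Proof.
move=> sX cX par.
have [p0 [tp0 lp0 _]] : exists q, [/\ trail X x q, last x q = y & size ([::] : seq T) <= size q].
  exact: trail_complete.
move: {2}(#|X| - size p0) (leqnn (#|X| - size p0)) => n.
elim: n p0 tp0 lp0 => [|n IH] p tp lp hn.
all: have [sub|/(trail_splice sX cX par tp lp)] := boolP (X \subset [set E in tedges x p]).
1,3: exists p; split=> //; have [/allP ap up] := andP tp.
1,2: apply: uniq_perm => //; [exact: enum_uniq|move=> E; rewrite mem_enum].
1,2: by apply/idP/idP => [/ap//|EX]; have := subsetP sub E EX; rewrite inE.
  by case=> q [/trail_size tq lq sq]; lia.
case=> q [tq lq sq]; have h := trail_size tq; apply: IH tq lq _; lia.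
Qed.

End Degrees.

(** * Degree reduction *)

Section Averaging.
Variable T : finType.
Implicit Types (X Y Z : {set {set T}}) (x y v : T) (p seen : seq T).

(** The edges by which the walk reaches a vertex outside [seen] for the first time; they grow a tree
    out of the vertices already seen. *)
Fixpoint first_visits seen x p : seq {set T} :=
  if p is z :: p' then
    if z \in seen then first_visits seen z p'
    else [set x; z] :: first_visits (z :: seen) z p'
  else [::].

Lemma first_visits_sub seen x p : {subset first_visits seen x p <= tedges x p}.
Proof.
elim: p seen x => [|z p IH] seen x E //=; rewrite inE.
case: ifP => _; first by move=> /IH ->; rewrite orbT.
by rewrite inE => /orP[->//|/IH ->]; rewrite orbT.
Qed.

Lemma first_visits_conn Z r seen x p :
  {subset first_visits seen x p <= Z} -> x \in seen -> {in seen, forall s, conn Z r s} ->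
  {in p, forall z, conn Z r z}.
Proof.
elim: p seen x => [|z p IH] seen x //=; case: ifP => hz sZ xs cs y.
  by rewrite inE => /orP[/eqP ->|]; [apply: cs|apply: IH sZ _ cs _].
have cz : conn Z r z.
  by apply: conn_trans (cs _ xs) (conn_edge _); apply: sZ; rewrite mem_head.
rewrite inE => /orP[/eqP -> //|]; apply: (IH (z :: seen) z) => //; last 1 first.
- by move=> s; rewrite inE => /orP[/eqP ->|/cs].
- by move=> E hE; apply: sZ; rewrite inE hE orbT.
exact: mem_head.
Qed.

(** At most one selected edge enters v, and only if v is new. Every other selected edge at v is a
    step leaving v, counted by [belast]. *)
Lemma count_first_visits seen x p v :
  count (fun E : {set T} => v \in E) (first_visits seen x p)
  <= (v \notin seen) + count_mem v (belast x p).
Proof.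
elim: p seen x => [|z p IH] seen x //=; case: ifP => hz /=.
  by apply: leq_trans (IH _ _) _; rewrite leq_add2l leq_addl.
have := IH (z :: seen) z; rewrite !inE [x == v]eq_sym.
move: (count _ _) (count _ _) => a b; rewrite negb_or.
case: (eqVneq v z) => [->|_]; rewrite ?hz; case: (v == x) => //=; try lia.
all: by case: (v \in seen) => /=; lia.
Qed.

Lemma count_tedges x p v : (forall a b, [set a; b] \in tedges x p -> a != b) ->
  count (fun E : {set T} => v \in E) (tedges x p) = count_mem v (belast x p) + count_mem v p.
Proof.
elim: p x => [|z p IH] x //= nl; rewrite IH; last first.
  by move=> a b h; apply: nl; rewrite inE h orbT.
have nxz : x != z by apply: nl; rewrite mem_head.
rewrite !inE ![_ == v]eq_sym.
by case: (eqVneq v x) => [->|_] /=; rewrite ?(negPf nxz); lia.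
Qed.

Lemma count_belast x p v : last x p = x -> count_mem v (belast x p) = count_mem v p.
Proof.
move=> lp; have := congr1 (count_mem v) (lastI x p).
by rewrite -cats1 count_cat /= lp; lia.
Qed.

Lemma deg_count X (s : seq {set T}) v : perm_eq s (enum X) ->
  deg X v = count (fun E : {set T} => v \in E) s.
Proof.
move/permP=> ->; rewrite /deg cardE -size_filter; congr size.
rewrite /enum_mem -filter_predI; apply: eq_filter => E.
by rewrite !inE /= andbC.
Qed.

(* The first-visit edges of an Euler tour of the even graph: at most one edge entering v,
   and at most half of the tour edges at v leave v. *)
Lemma connected_halved_degree X Y : simple X -> simple Y -> [disjoint X & Y] ->
  connected_edges X -> connected_edges Y ->
  exists Z, [/\ Z \subset X :|: Y, connected_edges Z &
    forall v, 2 * deg Z v <= deg X v + deg Y v + 2].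
Proof.
move=> sX sY dXY cX cY.
have [T0|/card_gt0P[r _]] := posnP #|T|.
  exists set0; split; [exact: sub0set|by move=> v; have := card0_eq T0 v; rewrite inE..].
have [E [_ sE cE ev]] := even_connected sX sY dXY cX cY.
have sXY : simple (X :|: Y).
  apply/forallP=> F; apply/implyP=> /setUP[FX|FY].
    by move/forallP: sX => /(_ F); rewrite FX.
  by move/forallP: sY => /(_ F); rewrite FY.
have siE := simple_sub sE sXY.
have [|p [lp pe]] := @euler_trail T E r r siE cE.
  by move=> v; rewrite addbb (negPf (ev v)).
pose Z := [set F in first_visits [:: r] r p].
have sZ : Z \subset E.
  apply/subsetP=> F; rewrite inE => /first_visits_sub; rewrite (perm_mem pe).
  by rewrite mem_enum.
have cr z : conn Z r z.
  have [->|nz] := eqVneq z r; first exact: conn0.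
  apply: (@first_visits_conn Z r [:: r] r p) => //.
  - by move=> F hF; rewrite inE.
  - exact: mem_head.
  - by move=> s; rewrite inE => /eqP ->; apply: conn0.
  have [||u [w [nu hw hE]]] := @conn_exit T E (predC1 z) r z (cE r z).
  + by rewrite /= eq_sym.
  + by rewrite /= eqxx.
  have {hw} ew : w = z by move: hw; rewrite /= negbK => /eqP.
  move: hE; rewrite ew -mem_enum -(perm_mem pe) => /tedges_vertices /(_ (set22 _ _)).
  by rewrite inE (negPf nz).
exists Z; split.
- exact: subset_trans sE.
- by move=> x y; apply: conn_trans (cr y); rewrite conn_sym.
move=> v; have dE := deg_sub v sE; rewrite deg_disjointU // in dE.
have dZ : deg Z v <= count (fun F : {set T} => v \in F) (first_visits [:: r] r p).
  rewrite -size_filter; apply: leq_trans (card_size _).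
  by apply/subset_leq_card/subsetP=> F; rewrite !inE mem_filter andbC.
have := count_first_visits [:: r] r p v.
have := deg_count v pe; rewrite count_tedges ?count_belast // => [|a b h]; last first.
  by apply: (simple_neq siE); rewrite -mem_enum -(perm_mem pe).
have : (v \notin [:: r]) <= 1 by case: (_ \notin _).
move: dZ dE; move: (count _ _) (count _ _) (deg Z v) (deg E v) (nat_of_bool _).
lia.
Qed.

(** The 2 ^ s classes are merged in pairs during s rounds. Each round replaces two degrees by at
    most their average plus one, whence the additive error s. *)
Lemma connected_low_degree (H : {set {set T}}) (c : {set T} -> nat) s i0 : simple H ->
  (forall i, i0 <= i < i0 + 2 ^ s -> connected_edges [set E in H | c E == i]) ->
  exists Z, [/\ Z \subset [set E in H | i0 <= c E < i0 + 2 ^ s], connected_edges Z &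
    forall v, deg Z v * 2 ^ s <= deg H v + s * 2 ^ s].
Proof.
move=> sH cH; set U := [set E in H | i0 <= c E < i0 + 2 ^ s].
(* The induction needs the degree in the band of colors itself, since the degrees of two half-bands
   add up. *)
suff [Z [h1 h2 h3]] : exists Z, [/\ Z \subset U, connected_edges Z &
    forall v, deg Z v * 2 ^ s <= deg U v + s * 2 ^ s].
  exists Z; split=> // v; apply: leq_trans (h3 v) _; rewrite leq_add2r deg_sub //.
  by apply/subsetP=> E; rewrite inE => /andP[].
rewrite {}/U; elim: s i0 cH => [|s IH] i0 cH.
  exists [set E in H | c E == i0]; split=> [||v].
  - by apply/subsetP=> E; rewrite !inE => /andP[-> /eqP ->]; rewrite expn0 addn1 leqnn ltnSn.
  - by apply: cH; rewrite expn0 addn1 leqnn ltnSn.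
  rewrite expn0 mul0n addn0 muln1; apply: deg_sub; apply/subsetP=> E; rewrite !inE.
  by move=> /andP[-> /eqP ->]; rewrite addn1 leqnn ltnSn.
have e2 : 2 ^ s.+1 = 2 ^ s + 2 ^ s by rewrite expnS; lia.
have [|Z1 [s1 c1 d1]] := IH i0; first by move=> i hi; apply: cH; lia.
have [|Z2 [s2 c2 d2]] := IH (i0 + 2 ^ s); first by move=> i hi; apply: cH; lia.
set U1 := [set E in H | _] in s1 d1; set U2 := [set E in H | _] in s2 d2.
have dU : [disjoint U1 & U2].
  rewrite -setI_eq0; apply/eqP/setP=> E; rewrite !inE; case: (E \in H) => //=; lia.
have eU : [set E in H | i0 <= c E < i0 + 2 ^ s.+1] = U1 :|: U2.
  by apply/setP=> E; rewrite !inE; case: (E \in H) => //=; lia.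
have sU1 : simple Z1.
  by apply: simple_sub sH; apply: subset_trans s1 _; apply/subsetP=> E; rewrite inE => /andP[].
have sU2 : simple Z2.
  by apply: simple_sub sH; apply: subset_trans s2 _; apply/subsetP=> E; rewrite inE => /andP[].
have dZ : [disjoint Z1 & Z2] by apply: disjointWl s1 (disjointWr s2 dU).
have [Z [sZ cZ dgZ]] := connected_halved_degree sU1 sU2 dZ c1 c2.
exists Z; split=> // [|v].
  by rewrite eU; apply: subset_trans sZ _; apply: setUSS.
rewrite eU deg_disjointU //; have := d1 v; have := d2 v; have := dgZ v; rewrite e2.
move: (deg Z v) (deg Z1 v) (deg Z2 v) (deg U1 v) (deg U2 v) (2 ^ s) => a b1 b2 u1 u2 q.
clear; move=> h1 h2 h3.
have : (2 * a) * q <= (b1 + b2 + 2) * q by rewrite leq_mul2r h1 orbT.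
nia.
Qed.

End Averaging.

(** * Balanced halving of bipartite graphs *)

Section Halving.

(* Two edges uv and vw sharing v are merged into one edge uw; orienting them
   consistently with an orientation of uw keeps v balanced. *)
Lemma balanced_orientation (I T : finType) (X : {set I}) (p : I -> T * T) :
  exists d : I -> T * T,
    (forall e, d e = p e \/ d e = ((p e).2, (p e).1)) /\
    forall v, (\sum_(e in X) ((d e).1 == v) <= (\sum_(e in X) ((d e).2 == v)).+1) &&
              (\sum_(e in X) ((d e).2 == v) <= (\sum_(e in X) ((d e).1 == v)).+1).
Proof.
move: {2}#|X| (leqnn #|X|) p => n; elim: n X => [|n IH] X.
  rewrite leqn0 cards_eq0 => /eqP -> p; exists p; split=> [e|v]; first by left.
  by rewrite !big_set0.
move=> hn p.
have [|] := boolP [exists e in X, exists f in X, exists v, [&& e != f,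
  v \in [:: (p e).1; (p e).2] & v \in [:: (p f).1; (p f).2]]]; last first.
  (* If no two edges share a vertex, each vertex occurs at most once as a first end and at most once
     as a second end. *)
  move=> hno; exists p; split=> [e|v]; first by left.
  have le1 (g : I -> T) : (forall e, g e \in [:: (p e).1; (p e).2]) ->
      \sum_(e in X) (g e == v) <= 1.
    move=> hg; have [|hn0] := boolP [exists e in X, g e == v]; last first.
      rewrite big1 // => e eX; move: hn0; rewrite negb_exists => /forallP/(_ e).
      by rewrite eX /= => /negPf ->.
    case/existsP=> e /andP[eX /eqP ge]; rewrite (bigD1 e) //= ge eqxx big1 ?addn0 // => f.
    case/andP=> fX nfe; apply/eqP; rewrite eqb0; apply: contra hno => /eqP gf.
    apply/existsP; exists e; rewrite eX; apply/existsP; exists f; rewrite fX.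
    by apply/existsP; exists v; rewrite eq_sym nfe -{1}ge hg -gf hg.
  have h1 := le1 (fun e => (p e).1) (fun e => mem_head _ _).
  have h2 : \sum_(e in X) ((p e).2 == v) <= 1.
    by apply: (le1 (fun e => (p e).2)) => e; rewrite !inE eqxx orbT.
  by rewrite (leq_trans h1) // (leq_trans h2).
case/existsP=> e /andP[eX /existsP[f /andP[fX /existsP[v /and3P[nef ve vf]]]]].
have other g : v \in [:: (p g).1; (p g).2] ->
    exists u, p g = (u, v) \/ p g = (v, u).
  by rewrite !inE; case: (p g) => a b /= /orP[/eqP ->|/eqP ->]; [exists b|exists a]; auto.
have [u pe] := other _ ve; have [w pf] := other _ vf.
have [|d' [dp dbal]] := IH (X :\ e) _ (fun g => if g == f then (u, w) else p g).
  by move: hn; rewrite (cardsD1 e) eX.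
pose b := d' f == (u, w).
pose d g := if g == e then (if b then (u, v) else (v, u))
            else if g == f then (if b then (v, w) else (w, v)) else d' g.
exists d; split=> [g|z].
  rewrite /d; case: (eqVneq g e) => [->|nge].
    by case: (b); case: pe => ->; auto.
  case: (eqVneq g f) => [->|ngf]; first by case: (b); case: pf => ->; auto.
  by have := dp g; rewrite (negPf ngf).
have fX' : f \in X :\ e by rewrite !inE fX eq_sym nef.
have [r1 [r2 [e1 e2 e1' e2']]] : exists r1 r2,
    [/\ \sum_(g in X) ((d g).1 == z) = (v == z) + ((d' f).1 == z) + r1,
        \sum_(g in X) ((d g).2 == z) = (v == z) + ((d' f).2 == z) + r2,
        \sum_(g in X :\ e) ((d' g).1 == z) = ((d' f).1 == z) + r1 &
        \sum_(g in X :\ e) ((d' g).2 == z) = ((d' f).2 == z) + r2].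
  exists (\sum_(g in X :\ e | g != f) ((d' g).1 == z)), (\sum_(g in X :\ e | g != f) ((d' g).2 == z)).
  have big k : \sum_(g in X) (k (d g) == z) =
      (k (d e) == z) + ((k (d f) == z) + \sum_(g in X :\ e | g != f) (k (d' g) == z)).
    rewrite (big_setD1 e) //= (bigD1 f) //=; congr (_ + (_ + _)).
    apply: eq_bigr => g /andP[]; rewrite !inE => /andP[nge _] ngf.
    by rewrite /d (negPf nge) (negPf ngf).
  have de : d e = if b then (u, v) else (v, u) by rewrite /d eqxx.
  have df : d f = if b then (v, w) else (w, v) by rewrite /d eq_sym (negPf nef) eqxx.
  have d'f : d' f = if b then (u, w) else (w, u).
    by rewrite /b; have := dp f; rewrite eqxx; case: eqP => [->|h []] //.
  split; [rewrite (big fst)|rewrite (big snd)|by rewrite (bigD1 f)|by rewrite (bigD1 f)];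
  by rewrite de df d'f; case: (b) => /=; lia.
by have := dbal z; rewrite e1 e2 e1' e2'; lia.
Qed.

(** In a balanced orientation take the edges directed out of A. They are the outgoing edges at a
    vertex of A and the incoming ones at a vertex outside A, so at every vertex both halves differ
    by at most one. *)
Lemma halving (T : finType) (A : {set T}) (X : {set {set T}}) :
  (forall E, E \in X -> exists a b, [/\ a \in A, b \notin A & E = [set a; b]]) ->
  exists2 Y : {set {set T}}, Y \subset X &
    forall v, deg Y v <= (deg (X :\: Y) v).+1 /\ deg (X :\: Y) v <= (deg Y v).+1.
Proof.
move=> bX.
(* A nonempty X supplies a vertex r, used as the default pair for sets outside X. *)
have [->|[E0 /bX[r _]]] := set_0Vmem X.
  by exists set0 => // v; rewrite setD0.
have /fin_all_exists[p hp] : forall E, exists q : T * T,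
    E \in X -> [/\ q.1 \in A, q.2 \notin A & E = [set q.1; q.2]].
  move=> E; have [/bX[a [b h]]|nEX] := boolP (E \in X); first by exists (a, b).
  by exists (r, r).
have [d [dp dbal]] := balanced_orientation X p.
exists [set E in X | (d E).1 \in A] => [|v].
  by apply/subsetP=> E; rewrite inE => /andP[].
set Y := [set E in X | _].
have hd E : E \in X -> ((d E).1 \in A) != ((d E).2 \in A) /\ E = [set (d E).1; (d E).2].
  move=> EX; have [h1 h2 h3] := hp E EX.
  by case: (dp E) => -> /=; split; rewrite ?h1 ?(negPf h2) // setUC.
have sumE (q : pred {set T}) (Z : {set {set T}}) : [set E in Z | q E] \subset Z ->
    #|[set E in Z | q E]| = \sum_(E in Z) q E.
  move=> _; rewrite -sum1_card big_mkcond [RHS]big_mkcond; apply: eq_bigr => E _.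
  by rewrite inE; case: (E \in Z); case: (q E).
have eY : deg Y v = #|[set E in X | (if v \in A then (d E).1 else (d E).2) == v]|.
  apply: eq_card => E; rewrite !inE; case EX: (E \in X) => //=.
  have [hn eE] := hd E EX; rewrite [in v \in E]eE !inE.
  case vA: (v \in A); case dA: ((d E).1 \in A) hn => /= hn.
  - by rewrite orbC; case: eqP => [e2|_] /=; [move: hn; rewrite -e2 vA|rewrite eq_sym].
  - by apply/esym/eqP => e1; rewrite e1 vA in dA.
  - by case: eqP => [e1|_] /=; [rewrite -e1 vA in dA|rewrite eq_sym].
  by apply/esym/eqP=> e2; rewrite e2 vA in hn.
have eYc : deg (X :\: Y) v = #|[set E in X | (if v \in A then (d E).2 else (d E).1) == v]|.
  apply: eq_card => E; rewrite !inE; case EX: (E \in X) => //=; rewrite !andbT.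
  have [hn eE] := hd E EX; rewrite [in v \in E]eE !inE.
  case vA: (v \in A); case dA: ((d E).1 \in A) hn => /= hn.
  - by apply/esym/eqP=> e2; rewrite e2 vA in hn.
  - by case: eqP => [e1|_] /=; [rewrite -e1 vA in dA|rewrite eq_sym].
  - by apply/esym/eqP => e1; rewrite e1 vA in dA.
  by rewrite orbC; case: eqP => [e2|_] /=; [move: hn; rewrite -e2 vA|rewrite eq_sym].
have sub q : [set E in X | q E] \subset X by apply/subsetP=> E; rewrite inE => /andP[].
by have := dbal v; rewrite eY eYc !sumE //; case: (v \in A) => /andP[].
Qed.

End Halving.

(** * Reserved tails in a bipartite graph *)

Section Bipartite.
Variable T : finType.
Implicit Types (A S : {set T}) (X Y : {set {set T}}).

Definition bip A X := forall E, E \in X -> exists a b, [/\ a \in A, b \notin A & E = [set a; b]].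

Lemma bip_sub A X Y : X \subset Y -> bip A Y -> bip A X.
Proof. by move=> /subsetP s b E /s /b. Qed.

Lemma bipC A X : bip A X -> bip (~: A) X.
Proof.
move=> b E /b[x [y [xA yA ->]]]; exists y, x.
by rewrite !inE yA negbK xA setUC.
Qed.

Lemma bip_side A X x y : bip A X -> [set x; y] \in X -> (y \in A) = (x \notin A).
Proof.
move=> b /b[u [v [uA vA /set2_eqP[[-> ->]|[-> ->]]]]]; first by rewrite uA (negPf vA).
by rewrite uA vA.
Qed.

Lemma bip_simple A X : bip A X -> simple X.
Proof.
move=> b; apply/forallP=> E; apply/implyP=> /b[x [y [xA yA ->]]].
by rewrite cards2 (_ : x != y) //; apply: contraNneq yA => <-.
Qed.

Lemma bip_set2 A x y x' y' : x \in A -> x' \in A -> y \notin A -> y' \notin A ->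
  [set x; y] = [set x'; y'] -> x = x' /\ y = y'.
Proof.
by move=> xA x'A yA y'A /set2_eqP[//|[e1 e2]]; rewrite e1 (negPf y'A) in xA.
Qed.

Lemma deg_nbrs X v : simple X -> deg X v = #|[set z | [set v; z] \in X]|.
Proof.
move=> sX; rewrite -(card_in_imset (f := fun z => [set v; z])); last first.
  by move=> y z; rewrite !inE => hy hz /set2_eqP[[]|[e1 e2]] //; rewrite e2 e1.
apply: eq_card => E; rewrite !inE; apply/andP/imsetP => [[EX vE]|[z]].
  have [a [b [nab eE]]] := simpleP sX EX.
  move: vE; rewrite eE !inE => /orP[/eqP ->|/eqP ->]; first by exists b; rewrite ?inE -?eE.
  by exists a; rewrite ?inE setUC -?eE.
by rewrite inE => h ->; rewrite h set21.
Qed.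

(** All starting points lie in S and R is bipartite, so two chosen edges can coincide only if they
    start at the same vertex. At v it suffices to have one edge for each index starting there and c
    more for the forbidden vertices. *)
Lemma greedy_step (D : finType) S (R : {set {set T}}) (P : {set D}) (st : D -> T)
    (fb : D -> seq T) c :
  bip S R -> {in P, forall i, st i \in S} -> (forall i, size (fb i) <= c) ->
  (forall v, v \in S -> #|[set i in P | st i == v]| + c <= deg R v) ->
  exists n : D -> T,
    {in P, forall i, [set st i; n i] \in R /\ n i \notin fb i} /\
    {in P &, injective (fun i => [set st i; n i])}.
Proof.
move=> bR; move: {2}#|P| (leqnn #|P|) => m; elim: m P => [|m IH] P.
  rewrite leqn0 cards_eq0 => /eqP -> _ _ _; exists st.
  by split=> i; rewrite inE.
move=> hm hS hfb hdeg; have [->|[i iP]] := set_0Vmem P.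
  by exists st; split=> j; rewrite inE.
have [||||n [hn inj]] := IH (P :\ i); first by move: hm; rewrite (cardsD1 i) iP.
- by move=> j; rewrite inE => /andP[_]; apply: hS.
- exact: hfb.
- move=> v vS; apply: leq_trans (hdeg v vS); rewrite leq_add2r.
  by apply/subset_leq_card/subsetP=> j; rewrite !inE => /andP[/andP[_ ->] ->].
have sR := bip_simple bR.
pose U := [set n j | j in [set j in P :\ i | st j == st i]].
have [z] : exists z, z \in [set z | [set st i; z] \in R] :\: (U :|: [set z in fb i]).
  apply/set0Pn; rewrite -card_gt0.
  have h0 := hdeg _ (hS _ iP); rewrite deg_nbrs // in h0.
  have h1 : #|U| < #|[set j in P | st j == st i]|.
    apply: leq_ltn_trans (leq_imset_card _ _) _.
    rewrite [X in _ < X](cardsD1 i) !inE iP eqxx /= ltnS.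
    by apply/subset_leq_card/subsetP=> j; rewrite !inE => /andP[/andP[-> ->] ->].
  have h2 : #|[set z in fb i]| <= c.
    by apply: leq_trans (hfb i); rewrite cardsE; apply: card_size.
  have h3 := cardsD [set z | [set st i; z] \in R] (U :|: [set z in fb i]).
  have h4 := subset_leq_card (subsetIr [set z | [set st i; z] \in R] (U :|: [set z in fb i])).
  have h5 := leq_card_setU U [set z in fb i].
  by case: h5 => h5 _; lia.
rewrite !inE negb_or => /andP[/andP[zU zf] zR].
exists (fun j => if j == i then z else n j); split=> [j jP|j k jP kP].
  case: (eqVneq j i) => [->|nji]; first by split.
  by apply: hn; rewrite !inE nji.
have out j0 : j0 \in P -> j0 != i -> n j0 \notin S.
  move=> j0P nj; have [|h _] := hn j0; first by rewrite !inE nj.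
  by rewrite (bip_side bR h) (hS _ j0P).
have zS : z \notin S by rewrite (bip_side bR zR) (hS _ iP).
case: (eqVneq j i) => [->|nji]; case: (eqVneq k i) => [->|nki] //.
- move/(bip_set2 (hS _ iP) (hS _ kP) zS (out _ kP nki)) => [e1 e2].
  by move: zU; rewrite e2 imset_f // !inE nki kP e1 eqxx.
- move/(bip_set2 (hS _ jP) (hS _ iP) (out _ jP nji) zS) => [e1 e2].
  by move: zU; rewrite -e2 imset_f // !inE nji jP e1 eqxx.
by apply: inj; rewrite !inE ?nji ?nki.
Qed.

(** Distinct arrivals at w use distinct edges, so the degree in R bounds the load at w for the next
    greedy step. *)
Lemma card_arrivals (D : finType) (R : {set {set T}}) (P : {set D}) (st n : D -> T) w :
  {in P, forall i, [set st i; n i] \in R} ->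
  {in P &, injective (fun i => [set st i; n i])} ->
  #|[set i in P | n i == w]| <= deg R w.
Proof.
move=> hR inj; rewrite -(card_in_imset (f := fun i => [set st i; n i])); last first.
  by move=> i j; rewrite !inE => /andP[iP _] /andP[jP _]; apply: inj.
apply/subset_leq_card/subsetP=> E /imsetP[i]; rewrite inE => /andP[iP /eqP <-] ->.
by rewrite inE hR // set22.
Qed.

Lemma perm_flatten_map4 (D R : eqType) (a b c d : D -> R) (s : seq D) :
  perm_eq (flatten [seq [:: a i; b i; c i; d i] | i <- s]) (map a s ++ map b s ++ map c s ++ map d s).
Proof.
elim: s => [|i s IH] //=; apply/permP=> q; move/permP/(_ q): IH.
by do 3 rewrite /= !count_cat; move=> /= ->; lia.
Qed.

(* The reserve X is halved four times and the smallest part is used for the first step,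
   so that at each vertex the next part absorbs all the arrivals. *)
Lemma tails_from_side (D : finType) A X (P : {set D}) (st : D -> T) (fb : D -> seq T) c :
  bip A X -> {in P, forall i, st i \in A} -> (forall i, size (fb i) <= c) ->
  (forall v, 16 * (#|[set i in P | st i == v]| + c + 2) <= deg X v) ->
  exists tl : D -> seq T, [/\ {in P, forall i, size (tl i) = 4},
    {in P, forall i, all (fun z => z \notin fb i) (tl i)},
    {in P, forall i, all (mem X) (tedges (st i) (tl i))} &
    uniq (flatten [seq tedges (st i) (tl i) | i <- enum P])].
Proof.
move=> bX hA hfb hdeg.
have [Y1 s1 d1] := halving bX; set X1 := X :\: Y1 in d1.
have t1 v : deg X v = deg Y1 v + deg X1 v by apply: deg_setD.
have bX1 : bip A X1 by apply: bip_sub bX; apply: subsetDl.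
have [Y2 s2 d2] := halving bX1; set X2 := X1 :\: Y2 in d2.
have t2 v : deg X1 v = deg Y2 v + deg X2 v by apply: deg_setD.
have bX2 : bip A X2 by apply: bip_sub bX1; apply: subsetDl.
have [Y3 s3 d3] := halving bX2; set X3 := X2 :\: Y3 in d3.
have t3 v : deg X2 v = deg Y3 v + deg X3 v by apply: deg_setD.
have bX3 : bip A X3 by apply: bip_sub bX2; apply: subsetDl.
have [Y4 s4 d4] := halving bX3; set X4 := X3 :\: Y4 in d4.
have t4 v : deg X3 v = deg Y4 v + deg X4 v by apply: deg_setD.
have bY1 := bipC (bip_sub s1 bX); have bY2 := bip_sub s2 bX1.
have bY3 := bipC (bip_sub s3 bX2); have bY4 := bip_sub s4 bX3.
(* The factor 16 pays for four halvings, and the summand 2 for their rounding. *)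
have cap v : [/\ #|[set i in P | st i == v]| + c <= deg Y4 v, deg Y4 v + c <= deg Y3 v,
    deg Y3 v + c <= deg Y2 v & deg Y2 v + c <= deg Y1 v].
  move: (hdeg v) (d1 v) (t1 v) (d2 v) (t2 v) (d3 v) (t3 v) (d4 v) (t4 v) => h0 h1 h2 h3 h4 h5 h6 h7 h8.
  by split; lia.
have [|n1 [h1 i1]] := @greedy_step D A Y4 P st fb c bY4 hA hfb.
  by move=> v _; case: (cap v).
have hR1 : {in P, forall i, [set st i; n1 i] \in Y4} by move=> i /h1[].
have o1 : {in P, forall i, n1 i \in ~: A}.
  by move=> i iP; rewrite inE (bip_side bY4 (hR1 i iP)) hA.
have [|n2 [h2 i2]] := @greedy_step D (~: A) Y3 P n1 fb c bY3 o1 hfb.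
  move=> v _; case: (cap v) => _ h _ _; apply: leq_trans h; rewrite leq_add2r.
  exact: card_arrivals hR1 i1.
have hR2 : {in P, forall i, [set n1 i; n2 i] \in Y3} by move=> i /h2[].
have o2 : {in P, forall i, n2 i \in A}.
  by move=> i iP; rewrite -[_ \in A]negbK -in_setC (bip_side bY3 (hR2 i iP)) negbK o1.
have [|n3 [h3 i3]] := @greedy_step D A Y2 P n2 fb c bY2 o2 hfb.
  move=> v _; case: (cap v) => _ _ h _; apply: leq_trans h; rewrite leq_add2r.
  exact: card_arrivals hR2 i2.
have hR3 : {in P, forall i, [set n2 i; n3 i] \in Y2} by move=> i /h3[].
have o3 : {in P, forall i, n3 i \in ~: A}.
  by move=> i iP; rewrite inE (bip_side bY2 (hR3 i iP)) o2.
have [|n4 [h4 i4]] := @greedy_step D (~: A) Y1 P n3 fb c bY1 o3 hfb.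
  move=> v _; case: (cap v) => _ _ _ h; apply: leq_trans h; rewrite leq_add2r.
  exact: card_arrivals hR3 i3.
have hR4 : {in P, forall i, [set n3 i; n4 i] \in Y1} by move=> i /h4[].
exists (fun i => [:: n1 i; n2 i; n3 i; n4 i]); split=> [//|i iP|i iP|].
- by rewrite /= (proj2 (h1 i iP)) (proj2 (h2 i iP)) (proj2 (h3 i iP)) (proj2 (h4 i iP)).
- have q1 := subsetP s1; have q2 := subset_trans s2 (subsetDl X Y1).
  have q3 := subset_trans (subset_trans s3 (subsetDl _ _)) (subsetDl X Y1).
  have q4 := subset_trans (subset_trans (subset_trans s4 (subsetDl _ _)) (subsetDl _ _)) (subsetDl X Y1).
  rewrite /= (q1 _ (hR4 i iP)) (subsetP q2 _ (hR3 i iP)) (subsetP q3 _ (hR2 i iP)).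
  by rewrite (subsetP q4 _ (hR1 i iP)).
rewrite /tedges /= (perm_uniq (perm_flatten_map4 _ _ _ _ _)).
have mapE (R : {set {set T}}) (a b : D -> T) : {in P, forall i, [set a i; b i] \in R} ->
    {in P &, injective (fun i => [set a i; b i])} ->
    uniq [seq [set a i; b i] | i <- enum P] /\
    {subset [seq [set a i; b i] | i <- enum P] <= R}.
  move=> hR inj; split.
    rewrite map_inj_in_uniq ?enum_uniq // => i j; rewrite !mem_enum; exact: inj.
  by move=> E /mapP[i]; rewrite mem_enum => /hR ? ->.
have [u1 m1] := mapE _ _ _ hR1 i1; have [u2 m2] := mapE _ _ _ hR2 i2.
have [u3 m3] := mapE _ _ _ hR3 i3; have [u4 m4] := mapE _ _ _ hR4 i4.
have sX2 : {subset Y3 <= X2} by apply/subsetP.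
have sX3 : {subset Y4 <= X3} by apply/subsetP.
have sX1 : {subset Y2 <= X1} by apply/subsetP.
have sD (B C : {set {set T}}) E : E \in B :\: C -> E \in B by rewrite inE => /andP[].
have nD (B C : {set {set T}}) E : E \in B :\: C -> E \notin C by rewrite inE => /andP[].
rewrite !cat_uniq u1 u2 u3 u4 /= !has_cat !negb_or /= !andbT.
apply/and3P; split.
- apply/and3P; split; apply/hasPn=> E.
  + by move=> /m2 hE; apply: contraL hE => /m1/sX3/nD.
  + by move=> /m3 hE; apply: contraL hE => /m1/sX3/sD/nD.
  by move=> /m4 hE; apply: contraL hE => /m1/sX3/sD/sD/nD.
- apply/andP; split; apply/hasPn=> E.
  + by move=> /m3 hE; apply: contraL hE => /m2/sX2/nD.
  by move=> /m4 hE; apply: contraL hE => /m2/sX2/sD/nD.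
by apply/hasPn=> E /m4 hE; apply: contraL hE => /m3/sX1/nD.
Qed.

(** Tails starting on opposite sides might compete for edges, so X is halved once more and each side
    gets a half of its own. This turns 16 into 32 and the summand 2 into 3. *)
Lemma tails (D : finType) A X (st : D -> T) (fb : D -> seq T) c :
  bip A X -> (forall i, size (fb i) <= c) ->
  (forall v, 32 * (#|[set i | st i == v]| + c + 3) <= deg X v) ->
  exists tl : D -> seq T, [/\ forall i, size (tl i) = 4,
    forall i, all (fun z => z \notin fb i) (tl i),
    forall i, all (mem X) (tedges (st i) (tl i)) &
    uniq (flatten [seq tedges (st i) (tl i) | i <- enum D])].
Proof.
move=> bX hfb hdeg.
have [Y sY dY] := halving bX; have tY v : deg X v = deg Y v + deg (X :\: Y) v by apply: deg_setD.
have bY := bip_sub sY bX; have bZ := bipC (bip_sub (subsetDl X Y) bX).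
pose P := [set i | st i \in A].
have cap v : forall B : {set D}, 16 * (#|[set i in B | st i == v]| + c + 2) <= deg Y v /\
    16 * (#|[set i in B | st i == v]| + c + 2) <= deg (X :\: Y) v.
  move=> B; have : #|[set i in B | st i == v]| <= #|[set i | st i == v]|.
    by apply/subset_leq_card/subsetP=> i; rewrite !inE => /andP[].
  by move: (hdeg v) (dY v) (tY v); lia.
have sP : {in P, forall i, st i \in A} by move=> i; rewrite inE.
have sC : {in ~: P, forall i, st i \in ~: A} by move=> i; rewrite !inE.
have [|t1 [a1 b1 c1 d1]] := tails_from_side bY sP hfb.
  by move=> v; case: (cap v P).
have [|t2 [a2 b2 c2 d2]] := tails_from_side bZ sC hfb.
  by move=> v; case: (cap v (~: P)).
exists (fun i => if i \in P then t1 i else t2 i).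
have hC i : i \notin P -> i \in ~: P by rewrite in_setC.
split=> [i|i|i|].
- by case: ifPn => [/a1|/hC/a2].
- by case: ifPn => [/b1|/hC/b2].
- by case: ifPn => [/c1|/hC/c2] /allP h; apply/allP => E /h;
    [apply: (subsetP sY)|rewrite /= inE => /andP[]].
have pD : perm_eq (enum D) (enum P ++ enum (~: P)).
  apply: uniq_perm; rewrite ?enum_uniq //.
    rewrite cat_uniq !enum_uniq andbT; apply/hasPn=> i; rewrite /= !mem_enum.
    by rewrite inE.
  by move=> i; rewrite mem_cat !mem_enum !inE orbN.
rewrite (perm_uniq (perm_flatten (perm_map _ pD))) map_cat flatten_cat.
have e1 : [seq tedges (st i) (if i \in P then t1 i else t2 i) | i <- enum P]
    = [seq tedges (st i) (t1 i) | i <- enum P].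
  by apply/eq_in_map => i; rewrite mem_enum => ->.
have e2 : [seq tedges (st i) (if i \in P then t1 i else t2 i) | i <- enum (~: P)]
    = [seq tedges (st i) (t2 i) | i <- enum (~: P)].
  by apply/eq_in_map => i; rewrite mem_enum in_setC => /negPf ->.
rewrite e1 e2 cat_uniq d1 d2 andbT /=.
apply/hasPn=> E /flatten_mapP[i]; rewrite mem_enum => /c2/allP h /h.
rewrite /= inE => /andP[nEY _]; apply: contra nEY => /flatten_mapP[j].
by rewrite mem_enum => /c1/allP h' /h'.
Qed.

End Bipartite.

(** * Cutting and repairing trails *)

Section PathLists.
Variable T : finType.
Implicit Types (A : {set T}) (H : {set {set T}}) (x y v : T) (p t : seq T) (L : seq (seq T)).

Definition path_edges t : seq {set T} := if t is x :: p then tedges x p else [::].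

Lemma flatten_uniq_inj (D : eqType) (R : eqType) (g : D -> seq R) (L : seq D) i j r :
  uniq (flatten (map g L)) -> i \in L -> j \in L -> r \in g i -> r \in g j -> i = j.
Proof.
elim: L => [|k L IH] //=; rewrite cat_uniq => /and3P[_ /hasPn h u].
rewrite !inE => /orP[/eqP ->|iL] /orP[/eqP ->|jL] // ri rj; last exact: IH.
  by have /negP[] : r \notin g k by apply: h; apply/flatten_mapP; exists j.
by have /negP[] : r \notin g k by apply: h; apply/flatten_mapP; exists i.
Qed.

Lemma path_edgesP x0 t E : size t = 6 -> reflect
  (exists2 i, i < 5 & E = [set nth x0 t i; nth x0 t i.+1]) (E \in path_edges t).
Proof.
case: t => [//|x p] [sp]; apply: (iffP (nthP set0)) => -[i].
  rewrite size_tedges sp => i5 <-; exists i => //.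
  by rewrite (nth_pairmap x0) ?sp.
by move=> i5 ->; exists i; rewrite ?size_tedges ?sp // (nth_pairmap x0) ?sp.
Qed.

Lemma is_P5_path_edges t : uniq t -> size t = 6 -> is_P5 [set E in path_edges t].
Proof.
case: t => [//|x p] u st; exists (fun i : 'I_6 => nth x (x :: p) i); split=> [i j /eqP|].
  by rewrite nth_uniq ?st // => /eqP/val_inj.
apply/setP=> E; rewrite inE; apply/(path_edgesP x E st)/imsetP => [[i i5 ->]|[i _ ->]].
  by exists (Ordinal i5).
by exists i.
Qed.

(** Paths are handled as vertex sequences from here on, and a single [perm_eq] expresses both
    disjointness and covering. *)
Lemma P5_decomposable_of_list (e : rel T) L :
  all (fun t => uniq t && (size t == 6)) L ->
  perm_eq (flatten (map path_edges L)) (enum (edges e)) -> P5_decomposable e.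
Proof.
move=> /allP aL pL.
have uL : uniq (flatten (map path_edges L)) by rewrite (perm_uniq pL) enum_uniq.
exists [set F in [seq [set E in path_edges t] | t <- L]]; split; last first.
  by move=> F; rewrite inE => /mapP[t /aL/andP[ut /eqP st] ->]; apply: is_P5_path_edges.
apply/and3P; split.
- rewrite eqEsubset; apply/andP; split; apply/subsetP=> E.
    case/bigcupP=> F; rewrite inE => /mapP[t tL ->]; rewrite inE => Et.
    by rewrite -mem_enum -(perm_mem pL); apply/flatten_mapP; exists t.
  rewrite -mem_enum -(perm_mem pL) => /flatten_mapP[t tL Et].
  by apply/bigcupP; exists [set E in path_edges t]; rewrite inE ?map_f.
- apply/trivIsetP=> F1 F2; rewrite !inE => /mapP[t1 t1L ->] /mapP[t2 t2L ->].
  apply: contraR; rewrite -setI_eq0 => /set0Pn[E]; rewrite !inE => /andP[E1 E2].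
  by rewrite (flatten_uniq_inj uL t1L t2L E1 E2).
rewrite inE; apply/mapP=> -[t /aL/andP[_ /eqP st] /setP] /(_ _).
case: t st => [//|x [//|y p]] _ /(_ [set x; y]).
by rewrite !inE eqxx.
Qed.

(** Vertices at odd distance along the trail lie on opposite sides, and vertices at distance two
    differ because consecutive edges do. Only the two pairs at distance four remain. *)
Lemma uniq_trail5 A H v0 v1 v2 v3 v4 v5 : bip A H ->
  all (mem H) (tedges v0 [:: v1; v2; v3; v4; v5]) -> uniq (tedges v0 [:: v1; v2; v3; v4; v5]) ->
  v0 != v4 -> v1 != v5 -> uniq [:: v0; v1; v2; v3; v4; v5].
Proof.
move=> bH /= /and5P[h1 h2 h3 h4 /andP[h5 _]].
have s1 := bip_side bH h1; have s2 := bip_side bH h2; have s3 := bip_side bH h3.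
have s4 := bip_side bH h4; have s5 := bip_side bH h5.
have nA a b : (a \in A) != (b \in A) -> (a == b) = false by apply: contraNF => /eqP ->.
have n2 a b c : [set a; b] != [set b; c] -> ((a : T) == c) = false.
  by apply: contraNF => /eqP ->; rewrite setUC.
rewrite !inE !negb_or => /and5P[/and4P[u1 u2 u3 _] /and3P[u4 _ _] /andP[u5 _] u6 _] n04 n15.
rewrite (n2 _ _ _ u1) (n2 _ _ _ u4) (n2 _ _ _ u5) (n2 _ _ _ u6) (negPf n04) (negPf n15).
rewrite !nA // ?s5 ?s4 ?s3 ?s2 ?s1 ?negbK; by case: (v0 \in A).
Qed.

Lemma cut_trail n x p : size p = 5 * n ->
  exists L, all (fun t => size t == 6) L /\ flatten (map path_edges L) = tedges x p.
Proof.
elim: n x p => [|n IH] x p hp; first by move: hp => /size0nil ->; exists [::].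
have e5 : size (take 5 p) = 5 by rewrite size_takel // hp; lia.
have [|L [aL eL]] := IH (last x (take 5 p)) (drop 5 p); first by rewrite size_drop hp; lia.
exists ((x :: take 5 p) :: L); split; first by rewrite /= e5.
by rewrite /= eL -tedges_cat cat_take_drop.
Qed.

Lemma tedges_rev x p : tedges (last x p) (rev (belast x p)) = rev (tedges x p).
Proof.
elim: p x => [|z p IH] x //=; rewrite rev_cons -cats1 tedges_cat IH rev_cons -cats1.
congr (_ ++ _) => /=; case: p {IH} => [|y p]; first by rewrite /= setUC.
by rewrite /= rev_cons last_rcons setUC.
Qed.

Section Repair.
(* Two special paths  w k b, b, n1, n2, n3 k b, n4  (k : bool) start at every vertex b;
   only their end vertices w k b change during the repair. *)
Variable n3 : bool -> T -> T.
Hypothesis n3_neq : forall b, n3 false b != n3 true b.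
Implicit Types (w : bool -> T -> T).

Definition end_edges w := [seq [set w i.1 i.2; i.2] | i <- enum {: bool * T}].
(* For a trail of length 5 in a bipartite graph this amounts to being a path. *)
Definition good t := if t is [:: v0; v1; _; _; v4; v5] then (v0 != v4) && (v1 != v5) else false.

(* The bad trail a b c d a p exchanges its end edge ab with an end edge at b. *)
Lemma repair_closed w v0 v1 v2 v3 v5 (t := [:: v0; v1; v2; v3; v0; v5]) :
  uniq (end_edges w ++ path_edges t) -> (forall j b, w j b != n3 j b) ->
  exists w' t', [/\ perm_eq (end_edges w' ++ path_edges t') (end_edges w ++ path_edges t),
    forall j b, w' j b != n3 j b & good t'].
Proof.
move=> u hw.
(* The vertex v0 becomes the first vertex of a special path at v1 and must avoid its fifth. The two
   fifth vertices differ, so one of the paths qualifies. *)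
have [j hj] : exists j, v0 != n3 j v1.
  have := n3_neq v1; have [e|ne _] := eqVneq v0 (n3 false v1); last by exists false.
  by rewrite -e; exists true.
pose w' j' b := if (j', b) == (j, v1) then v0 else w j' b.
exists w', [:: w j v1; v1; v2; v3; v0; v5].
have mi : (j, v1) \in enum {: bool * T} by rewrite mem_enum.
have pe (k : bool -> T -> T) : perm_eq (end_edges k)
    ([set k j v1; v1] :: [seq [set k i.1 i.2; i.2] | i <- rem (j, v1) (enum {: bool * T})]).
  by rewrite /end_edges (perm_map _ (perm_to_rem mi)).
have er : [seq [set w' i.1 i.2; i.2] | i <- rem (j, v1) (enum {: bool * T})] =
          [seq [set w i.1 i.2; i.2] | i <- rem (j, v1) (enum {: bool * T})].
  apply/eq_in_map => i; rewrite mem_rem_uniq ?enum_uniq // => /andP[ni _].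
  by rewrite /w' -surjective_pairing (negPf ni).
split.
- apply/permP=> q; rewrite !count_cat (permP (pe w')) (permP (pe w)) er /= /w' eqxx; lia.
- by move=> j' b; rewrite /w'; case: (eqVneq (j', b) (j, v1)) => [[-> ->]|].
(* Both inequalities of [good] come from distinct edges: the old end edge at v1 differs from v0v1,
   and v0v1 differs from v0v5. *)
move: u; rewrite cat_uniq => /and3P[_ /hasPn h /= /andP[ut _]].
apply/andP; split.
  have := h [set v0; v1] (mem_head _ _); apply: contraNneq => <-.
  by rewrite (perm_mem (pe w)) mem_head.
move: ut; rewrite !inE !negb_or => /and4P[_ _ _ h5].
by apply: contraNneq h5 => <-.
Qed.

Lemma repair_trail w t : size t = 6 ->
  uniq (end_edges w ++ path_edges t) -> (forall j b, w j b != n3 j b) ->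
  exists w' t', [/\ perm_eq (end_edges w' ++ path_edges t') (end_edges w ++ path_edges t),
    forall j b, w' j b != n3 j b & good t'].
Proof.
case: t => [|v0 [|v1 [|v2 [|v3 [|v4 [|v5 [|]]]]]]] // _ u hw.
have [e|n04] := eqVneq v0 v4; first by subst v4; apply: repair_closed.
have [e|n15] := eqVneq v1 v5; last first.
  by exists w, [:: v0; v1; v2; v3; v4; v5]; split=> //=; rewrite n04 n15.
subst v5.
(* Reversing the trail moves its 4-cycle to the beginning. *)
have pr : perm_eq (path_edges [:: v1; v4; v3; v2; v1; v0]) (path_edges [:: v0; v1; v2; v3; v4; v1]).
  have /= := tedges_rev v0 [:: v1; v2; v3; v4; v1]; rewrite /rev /= => ->.
  by apply/permP=> q /=; lia.
have [|//|w' [t' [p' h' g']]] := @repair_closed w v1 v4 v3 v2 v0.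
  by rewrite (perm_uniq (perm_cat (perm_refl _) pr)).
exists w', t'; split=> //; apply: perm_trans p' _.
exact: perm_cat.
Qed.

(** Repairing a trail touches only that trail and an end edge of a special path. Trails already
    repaired stay good, and the invariant on w keeps every special path available for the next
    exchange. *)
Lemma repair w L : all (fun t => size t == 6) L ->
  uniq (end_edges w ++ flatten (map path_edges L)) -> (forall j b, w j b != n3 j b) ->
  exists w' L', [/\ perm_eq (end_edges w' ++ flatten (map path_edges L'))
                            (end_edges w ++ flatten (map path_edges L)),
    forall j b, w' j b != n3 j b & all good L'].
Proof.
elim: L w => [|t L IH] w; first by exists w, [::].
case/andP=> /eqP st aL u hw.
have [|w1 [t1 [p1 h1 g1]]] := repair_trail st _ hw.
  by move: u; rewrite /= catA cat_uniq => /and3P[].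
have pL (L0 : seq {set T}) : perm_eq ((end_edges w1 ++ L0) ++ path_edges t1)
    (end_edges w ++ path_edges t ++ L0).
  by apply/permP=> q; move/permP/(_ q): p1; rewrite !count_cat; lia.
have [|w2 [L2 [p2 h2 g2]]] := IH w1 aL _ h1.
  move: u; rewrite /= -(perm_uniq (pL _)) cat_uniq => /and3P[] //.
exists w2, (t1 :: L2); split=> //=; last by rewrite g1.
apply: perm_trans (pL _); apply/permP=> q; move/permP/(_ q): p2; rewrite !count_cat; lia.
Qed.

End Repair.
End PathLists.

Arguments path_edges {T} t.

(** * Edges inside the sides of the cut *)

Section Degenerate.
Variable T : finType.
Implicit Types (f : rel T) (x y v : T) (p t : seq T).

Definition path5_free f := forall x p, size p = 5 -> uniq (x :: p) -> ~~ path f x p.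

(** A path with k < 5 steps has k vertices before its last one, which cannot block all of the at
    least five neighbors. The edge kept at the last vertex shows that the degree bound applies to
    it. *)
Lemma greedy_path f x0 y0 k : symmetric f -> irreflexive f -> f x0 y0 ->
  (forall x y, f x y -> 4 < #|[set z | f x z]|) -> k <= 5 ->
  exists x p, [/\ size p = k, uniq (x :: p), path f x p & exists y, f (last x p) y].
Proof.
move=> symf irf f0 hd; elim: k => [|k IH] hk; first by exists x0, [::]; split=> //; exists y0.
have [|x [p [sp up pp [y ly]]]] := IH; first by lia.
have [z] : exists z, z \in [set z | f (last x p) z] :\: [set z in belast x p].
  apply/set0Pn; rewrite -card_gt0; have := hd _ _ ly.
  have := cardsD [set z | f (last x p) z] [set z in belast x p].
  have := subset_leq_card (subsetIr [set z | f (last x p) z] [set z in belast x p]).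
  have : #|[set z in belast x p]| <= k by rewrite -sp -(size_belast x) cardsE card_size.
  lia.
rewrite !inE => /andP[nz lz]; exists x, (rcons p z).
rewrite size_rcons sp rcons_path pp lz last_rcons -rcons_cons rcons_uniq up andbT; split=> //.
  rewrite lastI mem_rcons inE negb_or nz andbT.
  by apply: contraTneq lz => ->; rewrite irf.
by exists (last x p); rewrite symf.
Qed.

(** By [greedy_path], a graph with an edge but without a path of length 5 has a non-isolated vertex
    of degree at most 4. Direct its edges outwards, delete it and repeat. The orientation tells at
    which end the tail of an edge will start, at most four per vertex. *)
Lemma degenerate_orientation f : symmetric f -> irreflexive f -> path5_free f ->
  exists O : {set T * T}, [/\ forall x y, f x y -> ((x, y) \in O) (+) ((y, x) \in O),
    forall x y, (x, y) \in O -> f x y &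
    forall x, #|[set i in O | i.1 == x]| <= 4].
Proof.
move: {2}#|[set i | f i.1 i.2]| (leqnn #|[set i | f i.1 i.2]|) => n.
elim: n f => [|n IH] f hn symf irf free.
  exists set0; split=> [x y fxy|x y|x]; rewrite ?inE //.
    by move: hn; rewrite leqn0 cards_eq0 => /eqP/setP/(_ (x, y)); rewrite !inE /= fxy.
  by rewrite (_ : [set _ in _ | _] = set0) ?cards0 //; apply/setP => i; rewrite !inE.
have [|hno] := boolP [exists x, exists y, f x y && (#|[set z | f x z]| <= 4)]; last first.
  have [/existsP[x0 /existsP[y0 f0]]|hf] := boolP [exists x, exists y, f x y]; last first.
    exists set0; split=> [x y fxy|x y|x]; rewrite ?inE //.
      by case/negP: hf; apply/existsP; exists x; apply/existsP; exists y.
    by rewrite (_ : [set _ in _ | _] = set0) ?cards0 //; apply/setP => i; rewrite !inE.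
  have hd x y : f x y -> 4 < #|[set z | f x z]|.
    move=> fxy; rewrite ltnNge; apply: contra hno => h.
    by apply/existsP; exists x; apply/existsP; exists y; rewrite fxy.
  have [x [p [sp up pp _]]] := greedy_path symf irf f0 hd (leqnn 5).
  by have := free x p sp up; rewrite pp.
case/existsP=> a /existsP[b /andP[fab da]].
pose f' : rel T := [rel x y | [&& f x y, x != a & y != a]].
have [||||O [h1 h2 h3]] := IH f'.
- rewrite -ltnS; apply: leq_trans hn; apply: proper_card; apply/properP; split.
    by apply/subsetP=> -[x y]; rewrite !inE => /andP[].
  by exists (a, b); rewrite inE /= /f' /= ?fab ?eqxx ?andbF.
- by move=> x y; rewrite /f' /= symf; congr (_ && _); rewrite andbC.
- by move=> x; rewrite /f' /= irf.
- move=> x p sp up; apply: contra (free x p sp up); by apply: sub_path => u v /andP[].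
exists (O :|: [set (a, z) | z in [set z | f a z]]); split.
- move=> x y fxy; rewrite !inE.
  have inI u v : ((u, v) \in [set (a, z) | z in [set z | f a z]]) = (u == a) && f a v.
    apply/imsetP/andP => [[z]|[/eqP -> h]]; first by rewrite inE => h [-> ->]; rewrite eqxx.
    by exists v; rewrite ?inE.
  rewrite !inI; have [ex|nx] := eqVneq x a.
    have yna : y != a by apply: contraTneq fxy => ->; rewrite ex irf.
    have nO u v : (u == a) || (v == a) -> ((u, v) \in O) = false.
      by apply: contraTF => /h2 /= /and3P[_ /negPf -> /negPf ->].
    rewrite !nO ?ex ?eqxx ?orbT //= (negPf yna) /=; move: fxy; rewrite ex => ->.
    by [].
  have [ey|ny] := eqVneq y a.
    have nO u v : (u == a) || (v == a) -> ((u, v) \in O) = false.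
      by apply: contraTF => /h2 /= /and3P[_ /negPf -> /negPf ->].
    by rewrite !nO ?ey ?eqxx ?orbT //=; move: fxy; rewrite ey symf => ->.
  by rewrite !orbF; apply: h1; rewrite /f' /= fxy nx ny.
- move=> x y; rewrite inE => /orP[/h2/and3P[]//|/imsetP[z]].
  by rewrite inE => h [-> ->].
move=> x; have [ex|nx] := eqVneq x a.
  apply: leq_trans da; rewrite -[X in _ <= X](card_imset _ (f := fun z => (a, z))); last by move=> u v [].
  apply/subset_leq_card/subsetP=> -[u v]; rewrite inE in_setU => /andP[/orP[hO|//] /eqP /= eu].
  by have := h2 _ _ hO; rewrite /f' /= eu ex eqxx /= andbF.
apply: leq_trans (h3 x); apply/subset_leq_card/subsetP=> -[u v].
rewrite !inE => /andP[/orP[-> -> //|/imsetP[z _ [-> _]]]] /= /eqP e.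
by rewrite e eqxx in nx.
Qed.

Lemma maximal_P5_packing (g : rel T) : symmetric g ->
  exists L : seq (seq T), [/\ all (fun t => uniq t && (size t == 6)) L,
    uniq (flatten (map path_edges L)), all (mem (edges g)) (flatten (map path_edges L)) &
    path5_free (fun x y => g x y && ([set x; y] \notin flatten (map path_edges L)))].
Proof.
move=> symg.
pose E := edges g.
pose ok (L : seq (seq T)) := [&& all (fun t => uniq t && (size t == 6)) L,
  uniq (flatten (map path_edges L)) & all (mem E) (flatten (map path_edges L))].
have inE2 x y : ([set x; y] \in E) = g x y.
  apply/imsetP/idP => [[[u v] h /set2_eqP]|h]; last by exists (x, y).
  by move: h; rewrite inE /= => h [[-> ->]|[-> ->]] //; rewrite symg.
have szL L : ok L -> size L <= #|E|.
  case/and3P=> s u /allP a; apply: (@leq_trans (size (flatten (map path_edges L)))).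
    rewrite size_flatten /shape -map_comp; elim: L s {u a} => [//|t L IH] /= /andP[/andP[_ /eqP st] /IH].
    by case: t st => [//|x p] /= [sp]; rewrite size_tedges sp; lia.
  by rewrite cardE; apply: uniq_leq_size => // F /a; rewrite mem_enum.
pose f L : rel T := fun x y => g x y && ([set x; y] \notin flatten (map path_edges L)).
suff [L okL freeL] : exists2 L, ok L & path5_free (f L).
  by have [aL uL eL] := and3P okL; exists L.
have [n] := ubnP (#|E| - size ([::] : seq (seq T))).
have : ok [::] by [].
elim: n [::] => [//|n IH] L okL hn.
have [|no] := boolP [exists x, exists p : 5.-tuple T, uniq (x :: p) && path (f L) x p]; last first.
  exists L => // x p sp up; apply: contra no => pp; have /eqP sp' := sp.
  by apply/existsP; exists x; apply/existsP; exists (Tuple sp'); rewrite up.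
case/existsP=> x /existsP[p /andP[up pp]].
have okp : ok ((x :: p) :: L).
  have [aL uL eL] := and3P okL.
  have hp E0 : E0 \in tedges x p -> E0 \in E /\ E0 \notin flatten (map path_edges L).
    elim: (tval p) x pp {up} => [//|z q IHq] x /= /andP[/andP[gxz nxz] pq].
    by rewrite inE => /orP[/eqP ->|/(IHq _ pq)//]; rewrite inE2.
  apply/and3P; split.
  - by apply/andP; split=> //; rewrite up; rewrite /= size_tuple.
  - rewrite /= cat_uniq uL andbT; apply/andP; split; last first.
      by apply/hasPn=> E0; apply: contraL => /hp[].
    elim: (tval p) x up {pp hp} => [//|z q IHq] x /andP[nx uq] /=.
    rewrite IHq // andbT; apply/negP=> /tedges_vertices /(_ (set21 _ _)).
    by rewrite (negPf nx).
  by rewrite /= all_cat eL andbT; apply/allP=> E0 /hp[].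
have /= hs := szL _ okp; apply: (IH _ okp) => /=; move: hn hs; move: #|E| (size L) => a b; lia.
Qed.

End Degenerate.

(** * Visits of an Euler tour *)

Section Visits.
Variable T : finType.
Implicit Types (S : {set T}) (E : {set {set T}}) (x y z : T) (p : seq T) (V : seq (T * T * T)).

(** The walk is cut into consecutive pairs of edges, so the middle vertices are the vertices at odd
    positions only. *)
Fixpoint visits x p : seq (T * T * T) :=
  if p is y :: z :: p' then (x, y, z) :: visits z p' else [::].

Definition visit_edges (i : T * T * T) : seq {set T} := [:: [set i.1.1; i.1.2]; [set i.1.2; i.2]].

Definition links V : rel T := fun x z => has (fun i => (i.1.1 == x) && (i.2 == z)) V.

Lemma two_step_ind (Q : T -> seq T -> Prop) :
  (forall x, Q x [::]) -> (forall x y z p, Q z p -> Q x (y :: z :: p)) ->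
  forall x p, ~~ odd (size p) -> Q x p.
Proof.
move=> h0 h2 x p; have [n] := ubnP (size p); elim: n x p => [//|n IH] x [|y [|z p]] //= hn hp.
by apply: h2; apply: IH; [lia|rewrite negbK in hp].
Qed.

Lemma flatten_visits x p : ~~ odd (size p) -> flatten (map visit_edges (visits x p)) = tedges x p.
Proof. by move: x p; apply: two_step_ind => [//|x y z p /= ->]. Qed.

Lemma visits_side S E x p i : bip S E -> ~~ odd (size p) -> all (mem E) (tedges x p) -> x \in S ->
  i \in visits x p -> [/\ i.1.1 \in S, i.1.2 \notin S & i.2 \in S].
Proof.
move=> bE hp; move: x p hp; apply: two_step_ind => [//|x y z p IH] /= /and3P[h1 h2 hp] xS.
have yS : y \notin S by rewrite (bip_side bE h1) xS.
have zS : z \in S by rewrite (bip_side bE h2) yS.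
by rewrite inE => /orP[/eqP -> //|]; apply: IH.
Qed.

Lemma last_side S E x p : bip S E -> all (mem E) (tedges x p) ->
  (last x p \in S) = (x \in S) (+) odd (size p).
Proof.
move=> bE; elim: p x => [|y p IH] x /=; first by rewrite addbF.
by case/andP=> h /IH ->; rewrite (bip_side bE h); case: (x \in S); case: (odd _).
Qed.

Lemma visits_connect S E x p z : bip S E -> ~~ odd (size p) -> all (mem E) (tedges x p) -> x \in S ->
  z \in x :: p -> z \in S -> connect (links (visits x p)) x z.
Proof.
move=> bE hp; move: x p hp; apply: two_step_ind => [x|x y u p IH] /=.
  by move=> _ _; rewrite inE => /eqP -> _; apply: connect0.
case/and3P=> h1 h2 hp xS.
have yS : y \notin S by rewrite (bip_side bE h1) xS.
have uS : u \in S by rewrite (bip_side bE h2) yS.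
rewrite inE => /orP[/eqP -> _|]; first exact: connect0.
rewrite inE => /orP[/eqP ->|zp zS]; first by rewrite (negPf yS).
have /(connect_sub _) h := IH hp uS zp zS.
apply: (@connect_trans _ _ u); first by apply: connect1; rewrite /links /= !eqxx.
by apply: h => a b hab; apply: connect1; move: hab; rewrite /links /= => ->; rewrite orbT.
Qed.

(** Sides alternate along a walk, so a tour from r in S has even length, and its visits have both
    ends in S and the center outside. Consecutive visits share an end, which connects all of S
    through [links]. *)
Lemma even_connected_visits S E r : bip S E -> connected_edges E -> 1 < #|T| ->
  (forall v, ~~ odd (deg E v)) -> r \in S ->
  exists V, [/\ perm_eq (flatten (map visit_edges V)) (enum E),
    {in V, forall i, [/\ i.1.1 \in S, i.1.2 \notin S & i.2 \in S]} &
    {in S, forall x, connect (links V) r x}].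
Proof.
move=> bE cE T2 ev rS; have sE := bip_simple bE.
have [|p [lp pe]] := @euler_trail T E r r sE cE.
  by move=> v; rewrite addbb (negPf (ev v)).
have aE : all (mem E) (tedges r p) by apply/allP=> F; rewrite (perm_mem pe) mem_enum.
have hp : ~~ odd (size p).
  by have := last_side bE aE; rewrite lp rS; case: (odd _).
exists (visits r p); split=> [|i|x xS].
- by rewrite flatten_visits.
- exact: visits_side bE hp aE rS.
apply: visits_connect bE hp aE rS _ xS.
have [->|nx] := eqVneq x r; first exact: mem_head.
have [||u [w [nu hw hE]]] := @conn_exit T E (predC1 x) r x (cE r x).
+ by rewrite /= eq_sym.
+ by rewrite /= eqxx.
have {hw} ew : w = x by move: hw; rewrite /= negbK => /eqP.
move: hE; rewrite ew -mem_enum -(perm_mem pe) => /tedges_vertices.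
by apply; rewrite set22.
Qed.

End Visits.

Lemma perm_enum_bool_prod (T : finType) :
  perm_eq (enum {: bool * T}) ([seq (false, v) | v <- enum T] ++ [seq (true, v) | v <- enum T]).
Proof.
apply: uniq_perm; first exact: enum_uniq.
  rewrite cat_uniq; apply/and3P; split; last 1 first.
  - by rewrite map_inj_uniq ?enum_uniq // => ? ? [].
  - by rewrite map_inj_uniq ?enum_uniq // => ? ? [].
  by apply/hasPn=> i /mapP[v _ ->]; apply/mapP=> -[].
by move=> [[] v]; rewrite mem_enum mem_cat; apply/esym/orP; [right|left];
  apply: map_f; rewrite mem_enum.
Qed.

Lemma perm_enum_sum (S T : finType) :
  perm_eq (enum {: S + T}) ([seq inl v | v <- enum S] ++ [seq inr j | j <- enum T]).
Proof.
apply: uniq_perm; first exact: enum_uniq.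
  rewrite cat_uniq; apply/and3P; split; last 1 first.
  - by rewrite map_inj_uniq ?enum_uniq // => ? ? [].
  - by rewrite map_inj_uniq ?enum_uniq // => ? ? [].
  by apply/hasPn=> i /mapP[v _ ->]; apply/mapP=> -[].
by move=> [v|j]; rewrite mem_enum mem_cat; apply/esym/orP; [left|right];
  apply: map_f; rewrite mem_enum.
Qed.

(** * Special paths and tails within one reserve *)

Section Specials.
Variables (T J : finType) (A : {set T}) (R : {set {set T}}) (st : J -> T) (fb : J -> seq T).
Hypotheses (bR : bip A R) (hfb : forall j, size (fb j) <= 3).
Hypothesis hdeg : forall v, 129 * (#|[set j | st j == v]| + 7) <= deg R v.

(** In the path formed by [w k v], v and [ts k v], entries 2 and 3 of the tail are the last two
    vertices, so the inequalities against them are those of [good]. The factor 129 = 4 * 32 + 1 pays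
    for two halvings before [tails]; in 7 = 1 + 3 + 3 the 1 is a special path starting at v, and the
    rest is the demand of [tails] with three forbidden vertices. *)
Lemma specials_and_tails :
  exists (w : bool -> T -> T) (ts : bool -> T -> seq T) (tj : J -> seq T), [/\
    [/\ forall k v, size (ts k v) = 4, forall k v, w k v != nth v (ts k v) 2,
        forall k v, v != nth v (ts k v) 3 & forall v, nth v (ts false v) 2 != nth v (ts true v) 2],
    (forall j, size (tj j) = 4) /\ (forall j, all (fun z => z \notin fb j) (tj j)) &
    let U := end_edges w ++ flatten [seq tedges i.2 (ts i.1 i.2) | i <- enum {: bool * T}]
             ++ flatten [seq tedges (st j) (tj j) | j <- enum J] in
    uniq U /\ all (mem R) U].
Proof.
have [X0 s0 d0] := halving bR; have t0 v : deg R v = deg X0 v + deg (R :\: X0) v by apply: deg_setD.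
have bR' : bip A (R :\: X0) by apply: bip_sub bR; apply: subsetDl.
have [X1 s1 d1] := halving bR'.
set X2 := (_ :\: X1) in d1; have t1 v : deg (R :\: X0) v = deg X1 v + deg X2 v by apply: deg_setD.
have [b0 b1] := (bip_sub s0 bR, bip_sub s1 bR').
have b2 : bip A X2 by apply: bip_sub bR'; apply: subsetDl.
have cap v : [/\ 160 <= deg X0 v, 32 * (#|[set j | st j == v]| + 7) <= deg X1 v & 224 <= deg X2 v].
  by move: (hdeg v) (d0 v) (t0 v) (d1 v) (t1 v); split; lia.
have capw v : 32 * (#|[set i : bool * T | i.2 == v]| + 0 + 3) <= deg X0 v.
  have h : #|[set i : bool * T | i.2 == v]| <= 2.
    rewrite -card_bool -(card_imset _ (f := fun k : bool => (k, v))); last by move=> ? ? [].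
    by apply/subset_leq_card/subsetP=> -[k x]; rewrite inE => /eqP /= ->; apply: imset_f.
  by case: (cap v) => h0 _ _; lia.
have [//|tw [sw _ aw uw]] := @tails T (bool * T)%type A X0 snd (fun=> [::]) 0 b0 _ capw.
(* only the first edge of each of these tails is used *)
pose w k v := nth v (tw (k, v)) 0.
have ew k v : [set w k v; v] \in tedges v (tw (k, v)).
  rewrite /w; have := sw (k, v); case: (tw (k, v)) => [//|a p] _ /=.
  by rewrite setUC mem_head.
(* The special paths with k = false and the tails indexed by J are produced by one application of
   [tails], hence are disjoint. *)
pose st1 (i : T + J) := match i with inl v => v | inr j => st j end.
pose fb1 (i : T + J) := match i with inl v => [:: w false v; v] | inr j => fb j end.
have cap1 v : 32 * (#|[set i | st1 i == v]| + 3 + 3) <= deg X1 v.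
  have h : #|[set i | st1 i == v]| <= (#|[set j | st j == v]|).+1.
    rewrite -(card_imset [set j | st j == v] (@inr_inj T J)) -add1n -(cards1 (inl v : T + J)).
    apply: leq_trans (subset_leq_card _) (leq_card_setU _ _).1.
    apply/subsetP=> -[x|j]; rewrite !inE /= => h; first by rewrite (eqP h) eqxx.
    by rewrite imset_f ?orbT // inE.
  by case: (cap v) => _ h1 _; lia.
have hfb1 i : size (fb1 i) <= 3 by case: i => [v|j] //=.
have [t1' [sz1 f1 a1 u1]] := tails b1 hfb1 cap1.
pose fb2 v := [:: w true v; v; nth v (t1' (inl v)) 2].
have cap2 v : 32 * (#|[set i : T | i == v]| + 3 + 3) <= deg X2 v.
  have -> : [set i : T | i == v] = [set v] by apply/setP=> i; rewrite !inE.
  by rewrite cards1; case: (cap v).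
have [//|t2 [sz2 f2 a2 u2]] := @tails T T A X2 id fb2 3 b2 _ cap2.
pose ts (k : bool) v := if k then t2 v else t1' (inl v).
exists w, ts, (fun j => t1' (inr j)); split.
- have nn (v : T) (q : seq T) (b : seq T) k : size q = 4 -> k < 4 ->
      all (fun z => z \notin b) q -> nth v q k \notin b.
    by move=> sq hk /allP; apply; rewrite mem_nth ?sq.
  have h1 v k (hk : k < 4) := nn v _ _ k (sz1 (inl v)) hk (f1 (inl v)).
  have h2 v k (hk : k < 4) := nn v _ _ k (sz2 v) hk (f2 v).
  split=> [[] v|[] v|[] v|v].
  + exact: sz2.
  + exact: sz1.
  + by have := h2 v 2 isT; rewrite !inE !negb_or eq_sym => /and3P[].
  + by have := h1 v 2 isT; rewrite !inE !negb_or eq_sym => /andP[].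
  + by have := h2 v 3 isT; rewrite !inE !negb_or => /and3P[_ h _]; rewrite eq_sym.
  + by have := h1 v 3 isT; rewrite !inE !negb_or => /andP[_]; rewrite eq_sym.
  by have := h2 v 2 isT; rewrite !inE !negb_or => /and3P[_ _ h]; rewrite eq_sym.
- by split=> j; [apply: sz1|apply: (f1 (inr j))].
move=> U.
have pT := perm_enum_bool_prod T; have pJ := perm_enum_sum T J.
have pU : perm_eq U (end_edges w ++ flatten [seq tedges (st1 i) (t1' i) | i <- enum {: T + J}]
    ++ flatten [seq tedges v (t2 v) | v <- enum T]).
  rewrite /U perm_cat2l.
  have e1 := perm_flatten (perm_map (fun i => tedges i.2 (ts i.1 i.2)) pT).
  have e2 := perm_flatten (perm_map (fun i => tedges (st1 i) (t1' i)) pJ).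
  apply/permP=> q; rewrite !count_cat (permP e1) (permP e2) !map_cat !flatten_cat !count_cat -!map_comp.
  by rewrite /= addnAC.
have aE : all (mem X0) (end_edges w).
  by apply/allP=> E /mapP[[k v] _ ->]; apply: (allP (aw (k, v))); apply: ew.
have uE : uniq (end_edges w).
  rewrite map_inj_in_uniq ?enum_uniq // => -[k v] [k' v'] hi hi' /= eE.
  by apply: (flatten_uniq_inj uw hi hi' (ew k v)); rewrite /= eE; apply: ew.
have aJ : all (mem X1) (flatten [seq tedges (st1 i) (t1' i) | i <- enum {: T + J}]).
  by apply/allP=> E /flatten_mapP[i _]; apply: (allP (a1 i)).
have a2' : all (mem X2) (flatten [seq tedges v (t2 v) | v <- enum T]).
  by apply/allP=> E /flatten_mapP[i _]; apply: (allP (a2 i)).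
have n02 E : E \in R :\: X0 -> E \notin X0 by rewrite inE => /andP[].
have n12 E : E \in X2 -> E \notin X1 by rewrite inE => /andP[].
have s2 : X2 \subset R :\: X0 by apply: subsetDl.
rewrite (perm_uniq pU) (perm_all _ pU) !all_cat !cat_uniq uE u1 u2 !andbT /=; split.
  rewrite has_cat negb_or; apply/andP; split; [apply/andP; split|].
  - by apply/hasPn=> E /(allP aJ)/(subsetP s1)/n02; apply: contra => /(allP aE).
  - by apply/hasPn=> E /(allP a2')/(subsetP s2)/n02; apply: contra => /(allP aE).
  by apply/hasPn=> E /(allP a2')/n12; apply: contra => /(allP aJ).
apply/and3P; split; apply/allP=> E.
- by move=> /(allP aE)/(subsetP s0).
- by move=> /(allP aJ)/(subsetP s1); rewrite /= inE => /andP[].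
by move=> /(allP a2')/(subsetP s2); rewrite /= inE => /andP[].
Qed.

End Specials.

(** * The bipartite part *)

Section Core.
Variable T : finType.
Implicit Types (A S : {set T}) (H M X Y Z : {set {set T}}) (x y z v : T) (p t : seq T).

(* Packing 5 * 2 ^ 11 subgraphs requires cuts of size 10 * 2 ^ 11; averaging 2 ^ 11 of them
   adds at most 11 to a degree, which is small against the bound. *)
Definition conn_bound := 16 * 2 ^ 11.

Lemma deg_cut A H v : bip A H -> cut H [set v] \subset [set E in H | v \in E].
Proof.
move=> bH; apply/subsetP=> E; rewrite !inE => /and3P[-> /set0Pn[x h] _].
by move: h; rewrite !inE => /andP[h /eqP <-].
Qed.

Lemma deg_setU X Y v : deg (X :|: Y) v <= deg X v + deg Y v.
Proof.
apply: leq_trans (leq_card_setU _ _).1; apply/subset_leq_card/subsetP=> E.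
by rewrite !inE andb_orl.
Qed.

(** Five bands of 2 ^ 11 colors are averaged to degree at most deg H / 1000. Two bands make EA, one
    connected and one supplying the join that makes it even; two more make EB, and the last is C. *)
Lemma sparse_connected_subgraphs A H : 1 < #|T| -> bip A H ->
  (forall S, S != set0 -> S != setT -> conn_bound <= #|cut H S|) ->
  exists EA EB C : {set {set T}},
    [/\ [/\ EA \subset H, EB \subset H & C \subset H],
        [/\ [disjoint EA & EB], [disjoint EA & C] & [disjoint EB & C]],
        [/\ connected_edges EA, connected_edges EB & connected_edges C],
        (forall v, ~~ odd (deg EA v)) /\ (forall v, ~~ odd (deg EB v)) &
        forall v, 1000 * (deg EA v + deg EB v + deg C v) <= 5 * deg H v /\ conn_bound <= deg H v].
Proof.
move=> T2 bH hcut; have sH := bip_simple bH.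
have hd v : conn_bound <= deg H v.
  apply: leq_trans (subset_leq_card (deg_cut v bH)); apply: hcut.
    by apply/set0Pn; exists v; rewrite inE.
  by apply: contraTneq T2 => h; rewrite -cardsT -h cards1.
have [|||c hc] := @tree_packing T H (5 * 2 ^ 11) conn_bound.
- by move=> E /(simpleP sH)[x [y [_ ->]]]; exists x, y.
- by rewrite mulnA leq_mul2r orbT.
- exact: hcut.
have band j : j < 5 -> exists Z, [/\ Z \subset [set E in H | j * 2 ^ 11 <= c E < j.+1 * 2 ^ 11],
    connected_edges Z & forall v, 1000 * deg Z v <= deg H v].
  move=> j5; have [|Z [sZ cZ dZ]] := @connected_low_degree T H c 11 (j * 2 ^ 11) sH.
    move=> i /andP[_ hi]; apply: hc; apply: leq_trans hi _.
    by rewrite -mulSnr leq_mul2r; apply/orP; right.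
  exists Z; split=> //; first by rewrite mulSn addnC.
  move=> v; have h1 := dZ v; have h2 : 11 * 2 ^ 11 <= deg H v.
    by apply: leq_trans (hd v); rewrite leq_mul2r orbT.
  have h3 : deg Z v * 2 ^ 11 <= 2 * deg H v by lia.
  (* Here 2 ^ 11 = 2048 exceeds 2000. *)
  have h4 : 2 * (1000 * deg Z v) <= deg Z v * 2 ^ 11.
    by rewrite mulnA mulnC leq_mul2l; apply/orP; right.
  by rewrite -(@leq_pmul2l 2) //; apply: leq_trans h4 h3.
have [Z0 [s0 c0 d0]] := band 0 isT; have [Z1 [s1 c1 d1]] := band 1 isT.
have [Z2 [s2 c2 d2]] := band 2 isT; have [Z3 [s3 c3 d3]] := band 3 isT.
have [Z4 [s4 c4 d4]] := band 4 isT.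
have disj (i j : nat) (Zi Zj : {set {set T}}) : i < j ->
    Zi \subset [set E in H | i * 2 ^ 11 <= c E < i.+1 * 2 ^ 11] ->
    Zj \subset [set E in H | j * 2 ^ 11 <= c E < j.+1 * 2 ^ 11] -> [disjoint Zi & Zj].
  move=> ij si sj; apply: (disjointWl si); apply: (disjointWr sj).
  rewrite -setI_eq0; apply/eqP/setP=> E; rewrite !inE; apply/negP.
  case/andP=> /and3P[_ _ h1] /and3P[_ h2 _].
  by have := leq_trans h1 (leq_trans (leq_mul ij (leqnn _)) h2); rewrite ltnn.
have subH (i : nat) (Zi : {set {set T}}) : Zi \subset [set E in H | i * 2 ^ 11 <= c E < i.+1 * 2 ^ 11] -> Zi \subset H.
  by move=> s; apply: subset_trans s _; apply/subsetP=> E; rewrite inE => /andP[].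
have u X Y : X \subset H -> Y \subset H -> X :|: Y \subset H by rewrite subUset => -> ->.
have [EA [_ sA cA eA]] := even_connected (simple_sub (subH _ _ s0) sH) (simple_sub (subH _ _ s1) sH)
  (disj 0 1 _ _ isT s0 s1) c0 c1.
have [EB [_ sB cB eB]] := even_connected (simple_sub (subH _ _ s2) sH) (simple_sub (subH _ _ s3) sH)
  (disj 2 3 _ _ isT s2 s3) c2 c3.
have dU X Y Z : [disjoint X & Z] -> [disjoint Y & Z] -> [disjoint X :|: Y & Z].
  by rewrite -!setI_eq0 setIUl => /eqP -> /eqP ->; rewrite setU0.
exists EA, EB, Z4; split=> //.
- split; [apply: subset_trans sA _|apply: subset_trans sB _|exact: subH s4];
  by apply/u; [apply: (subH _ _ s0) || apply: (subH _ _ s2)|apply: (subH _ _ s1) || apply: (subH _ _ s3)].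
- split.
  + apply: (disjointWl sA); apply: (disjointWr sB); apply/dU; rewrite disjoint_sym; apply/dU;
    rewrite disjoint_sym; [exact: (disj _ _ _ _ _ s0 s2)|exact: (disj _ _ _ _ _ s0 s3)|exact: (disj _ _ _ _ _ s1 s2)|exact: (disj _ _ _ _ _ s1 s3)].
  + by apply: (disjointWl sA); apply/dU; [exact: (disj _ _ _ _ _ s0 s4)|exact: (disj _ _ _ _ _ s1 s4)].
  by apply: (disjointWl sB); apply/dU; [exact: (disj _ _ _ _ _ s2 s4)|exact: (disj _ _ _ _ _ s3 s4)].
move=> v; split=> //.
have hA := leq_trans (deg_sub v sA) (deg_setU _ _ v).
have hB := leq_trans (deg_sub v sB) (deg_setU _ _ v).
have dm : 1000 * (deg EA v + deg EB v + deg Z4 v) <=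
    1000 * (deg Z0 v + deg Z1 v + (deg Z2 v + deg Z3 v) + deg Z4 v).
  by rewrite leq_mul2l; apply/orP; right; rewrite leq_add2r leq_add.
apply: leq_trans dm _; rewrite !mulnDr.
rewrite (_ : 5 = 1 + 1 + (1 + 1) + 1) // !mulnDl mul1n.
by rewrite !leq_add.
Qed.

Lemma side_handshake A M : bip A M -> \sum_(v in A) deg M v = #|M|.
Proof.
move=> bM; rewrite /deg double_count -sum1_card; apply: eq_bigr => E /bM[a [b [aA bA ->]]].
apply/eqP/cards1P; exists a; apply/setP=> v; rewrite !inE.
by case: (eqVneq v a) => [->|_] /=; [rewrite aA|case: (eqVneq v b) => [->|]; rewrite ?andbF // (negPf bA)].
Qed.

(** Every edge has exactly one end in A, so the degrees over A sum to |M|, and r carries the parity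
    of this sum. *)
Lemma odd_side A M r : bip A M -> r \in A -> (forall v, v \in A -> v != r -> ~~ odd (deg M v)) ->
  odd (deg M r) = odd #|M|.
Proof.
move=> bM rA h; rewrite -(side_handshake bM) (big_morph odd oddD (erefl (odd 0))).
rewrite (bigD1 r) //= big1 ?addbF // => v /andP[vA nv].
by rewrite (negPf (h v vA nv)).
Qed.

(** The edge [ch s i] starts the path of visit i and leaves the rest of the graph. Switching the
    choice moves this loss from one end of the visit to the other and leaves the center as it is, so
    prescribing parities is a join problem on the links. *)
Lemma parity_choice (I : finType) (V : I -> T * T * T) M0 (root : T -> T)
    (ch := fun (s : I -> bool) i => [set (if s i then (V i).2 else (V i).1.1); (V i).1.2]) :
  (forall i, (V i).1.1 != (V i).1.2) -> (forall i, (V i).2 != (V i).1.2) ->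
  (forall s, injective (ch s)) -> (forall s i, ch s i \in M0) ->
  (forall x, connect (fun a b => [exists i, ((V i).1.1 == a) && ((V i).2 == b)]) (root x) x) ->
  exists s, forall v, (forall x, root x != v) -> ~~ odd (deg (M0 :\: [set ch s i | i : I]) v).
Proof.
move=> n1 n2 inj sub hc.
pose tog i v := (v == (V i).1.1) (+) (v == (V i).2).
pose c0 v := \big[addb/false]_i (v \in ch (fun=> false) i).
have symt : symmetric (toggles tog setT).
  move=> a b; apply: eq_existsb => i; congr (_ && _); apply: eq_forallb => v.
  by rewrite [(v == b) (+) _]addbC.
have [|s [_ hs]] := @parity_join I T tog setT root (fun v => odd (deg M0 v) (+) c0 v).
  move=> x; rewrite (sym_connect_sym symt); apply: connect_sub (hc x) => a b /existsP[i].
  case/andP=> /eqP ea /eqP eb; apply: connect1; apply/existsP; exists i; rewrite inE /=.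
  by apply/forallP=> v; rewrite /tog ea eb.
exists s => v hv; have sC : [set ch s i | i : I] \subset M0 by apply/subsetP=> E /imsetP[i _ ->].
have e1 : odd (deg [set ch s i | i : I] v) = \big[addb/false]_i (v \in ch s i).
  by rewrite /deg odd_card big_imset //= => i j _ _; apply: inj.
have e2 : \big[addb/false]_i (v \in ch s i) = c0 v (+) parity tog s v.
  rewrite /c0 /parity -big_split; apply: eq_bigr => i _ /=.
  rewrite /ch /tog !inE; case: (s i) => /=; last by rewrite addbF.
  have := n1 i; have := n2 i; case: (eqVneq v (V i).1.2) => [->|_]; last first.
    by rewrite !orbF; case: (v == _); case: (v == _).
  by rewrite !orbT ![_.1.2 == _]eq_sym => /negPf -> /negPf ->.
have := congr1 odd (deg_setD v sC); rewrite oddD e1 e2 hs //.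
by case: (odd (deg M0 v)); case: (c0 v); case: (odd _).
Qed.

End Core.

(** * Assembly of the bipartite decomposition *)

Section Assembly.
Variable T : finType.
Implicit Types (A S : {set T}) (H M X Y Z : {set {set T}}) (x y z v : T) (p t : seq T).

Lemma perm_flatten_cons (D R : eqType) (f : D -> R) (g : D -> seq R) (s : seq D) :
  perm_eq (flatten [seq f i :: g i | i <- s]) (map f s ++ flatten (map g s)).
Proof.
elim: s => [|i s IH] //=; apply/permP=> q; move/permP/(_ q): IH.
by rewrite /= !count_cat /= ?count_cat => ->; lia.
Qed.

Lemma size_flatten_map (D R : Type) (g : D -> seq R) k (s : seq D) :
  (forall i, size (g i) = k) -> size (flatten (map g s)) = k * size s.
Proof. by move=> hg; elim: s => [|i s IH] /=; rewrite ?muln0 // size_cat hg IH mulnS. Qed.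

Lemma uniq_flatten_mem (R : eqType) (s : seq (seq R)) r : uniq (flatten s) -> r \in s -> uniq r.
Proof.
elim: s => [//|a s IH] /=; rewrite cat_uniq inE => /and3P[ua _ us] /orP[/eqP -> //|].
exact: IH.
Qed.

Lemma uniq_good A H t : bip A H -> good t -> all (mem H) (path_edges t) -> uniq (path_edges t) ->
  uniq t && (size t == 6).
Proof.
case: t => [|v0 [|v1 [|v2 [|v3 [|v4 [|v5 [|]]]]]]] // bH /andP[n04 n15] a u.
by rewrite andbT; apply: (uniq_trail5 bH a u n04 n15).
Qed.

Lemma good_cons2 x y p : size p = 4 -> x != nth y p 2 -> y != nth y p 3 -> good [:: x, y & p].
Proof. by case: p => [|a [|b [|c [|d []]]]] //= _ -> ->. Qed.

(** The edge xy may lie inside a side, so sides do not separate y from the tail. This is why the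
    tail must avoid both x and y. *)
Lemma uniq_cons2 A H x y p : bip A H -> all (mem H) (tedges x p) -> uniq (tedges x p) ->
  size p = 4 -> all (fun z => z \notin [:: x; y]) p -> x != y ->
  uniq [:: y, x & p] && (size [:: y, x & p] == 6).
Proof.
case: p => [|a [|b [|c [|d []]]]] // bH /= /and5P[h1 h2 h3 h4 _].
have s1 := bip_side bH h1; have s2 := bip_side bH h2; have s3 := bip_side bH h3.
have s4 := bip_side bH h4.
have nA u v : (u \in A) != (v \in A) -> (u == v) = false by apply: contraNF => /eqP ->.
have n2 u v w : [set u; v] != [set v; w] -> ((u : T) == w) = false.
  by apply: contraNF => /eqP ->; rewrite setUC.
rewrite !inE !negb_or => /and4P[/and3P[u1 _ _] /andP[u2 _] u3 _] _.
case/and5P=> /andP[ax ay] /andP[bx by'] /andP[cx cy] /andP[dx dy] _ nxy.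
rewrite ![y == _]eq_sym ![x == _]eq_sym !(negPf ax, negPf ay, negPf bx, negPf by', negPf cx, negPf cy, negPf dx, negPf dy).
rewrite [y == x]eq_sym (negPf nxy) (n2 _ _ _ u2) (n2 _ _ _ u3).
rewrite !nA // ?s4 ?s3 ?s2 ?s1 ?negbK; by case: (x \in A).
Qed.

Lemma card_centers (I : finType) (V : I -> T * T * T) X v : simple X ->
  uniq (flatten [seq visit_edges (V i) | i <- enum I]) ->
  (forall i, all (mem X) (visit_edges (V i))) ->
  #|[set i | (V i).1.2 == v]| <= deg X v.
Proof.
move=> sX u a; rewrite -(card_in_imset (f := fun i => [set (V i).1.1; (V i).1.2])).
  apply/subset_leq_card/subsetP=> E /imsetP[i]; rewrite inE => /eqP <- ->.
  by rewrite inE set22 andbT; have /andP[] := a i.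
move=> i j _ _ e; apply: (flatten_uniq_inj u) (mem_enum _ i) (mem_enum _ j) _ _.
- exact: mem_head.
by rewrite e mem_head.
Qed.

(** O holds the oriented leftover edges inside the sides; the tail completing an edge starts at the
    first component. The divisibility hypothesis counts O because these edges are not in H. *)
Lemma bipartite_part A H (O : {set T * T}) : 1 < #|T| -> bip A H ->
  (forall S, S != set0 -> S != setT -> conn_bound <= #|cut H S|) ->
  {in O, forall o, o.1 != o.2} -> (forall x, #|[set o in O | o.1 == x]| <= 4) ->
  5 %| #|O| + #|H| ->
  exists L, all (fun t => uniq t && (size t == 6)) L /\
    perm_eq (flatten (map path_edges L)) ([seq [set o.1; o.2] | o <- enum O] ++ enum H).
Proof.
move=> T2 bH hcut nO dO d5; have sH := bip_simple bH.
have [EA [EB [C [[sA sB sC] [dAB dAC dBC] [cA cB cC] [eA eB] hdeg]]]] :=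
  sparse_connected_subgraphs T2 bH hcut.
have [rA [rB [rAA rBA]]] : exists rA rB, rA \in A /\ rB \notin A.
  have /card_gt0P[x _] : 0 < #|T| by apply: ltnW.
  have : 0 < deg H x by case: (hdeg x) => _; apply: leq_trans.
  by case/card_gt0P=> E; rewrite inE => /andP[/bH[a [b [aA bA _]]] _]; exists a, b.
have bA := bip_sub sA bH; have bB := bipC (bip_sub sB bH).
have [VA [pVA hVA lVA]] := even_connected_visits bA cA T2 eA rAA.
have rBC : rB \in ~: A by rewrite inE.
have [VB [pVB hVB lVB]] := even_connected_visits bB cB T2 eB rBC.
pose W := VA ++ VB; pose I := 'I_(size W); pose V (i : I) := tnth (in_tuple W) i.
have eV (R : Type) (g : T * T * T -> R) : [seq g (V i) | i <- enum I] = map g W.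
  by rewrite map_comp /V map_tnth_enum.
have pV : perm_eq (flatten [seq visit_edges (V i) | i <- enum I]) (enum (EA :|: EB)).
  rewrite eV map_cat flatten_cat; apply: perm_trans (perm_cat pVA pVB) _.
  apply: uniq_perm; rewrite ?enum_uniq //; last by move=> E; rewrite mem_cat !mem_enum inE.
  rewrite cat_uniq !enum_uniq andbT; apply/hasPn=> E; rewrite !mem_enum => EB'.
  by rewrite (disjointFl dAB EB').
have uV : uniq (flatten [seq visit_edges (V i) | i <- enum I]) by rewrite (perm_uniq pV) enum_uniq.
have aV i : all (mem (EA :|: EB)) (visit_edges (V i)).
  apply/allP=> E hE; rewrite /= -mem_enum -(perm_mem pV); apply/flatten_mapP.
  by exists i; rewrite ?mem_enum.
have sAB : EA :|: EB \subset H by rewrite subUset sA.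
have hV i : V i \in W by apply: mem_tnth.
pose R := H :\: (EA :|: EB :|: C).
have bR : bip A R by apply: bip_sub bH; apply: subsetDl.
pose J : finType := (I + {o | o \in O})%type.
pose st (j : J) := match j with inl i => (V i).1.2 | inr o => (val o).1 end.
pose fb (j : J) := match j with inl i => [:: (V i).1.1; (V i).1.2; (V i).2]
                              | inr o => [:: (val o).1; (val o).2] end.
(* At v start at most four tails for O and one for each visit centered at v. The latter number at
   most the degree in EA and EB together, a small fraction of deg H. *)
have cap v : 129 * (#|[set j | st j == v]| + 7) <= deg R v.
  have h1 : #|[set j | st j == v]| <= deg (EA :|: EB) v + 4.
    have h2 := @card_centers I V _ v (simple_sub sAB sH) uV aV.
    apply: leq_trans (leq_add h2 (dO v)).
    rewrite -(card_imset [set i | (V i).1.2 == v] (@inl_inj I {o | o \in O})).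
    have -> : #|[set o in O | o.1 == v]| = #|@inr I {o | o \in O} @: [set o | (val o).1 == v]|.
      rewrite card_imset; last by move=> ? ? [].
      rewrite -(card_imset _ val_inj); apply: eq_card => o; rewrite inE.
      apply/andP/imsetP => [[oO ov]|[o' h ->]]; last by rewrite inE in h; rewrite (valP o').
      by exists (Sub o oO); rewrite ?inE ?SubK.
    apply: leq_trans (subset_leq_card _) (leq_card_setU _ _).1.
    apply/subsetP=> -[i|o]; rewrite !inE /= => h; first by rewrite imset_f ?inE.
    by apply/orP; right; apply/imsetP; exists o; rewrite ?inE.
  have h2 : deg H v = deg (EA :|: EB :|: C) v + deg R v by apply: deg_setD; rewrite subUset sAB.
  have h3 := deg_setU (EA :|: EB) C v; have h4 := deg_setU EA EB v.
  have [h5 h6] := hdeg v.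
  (* The constant part of the demand is 129 * (4 + 7) = 1419, and about 0.35 deg H is left to cover
     it. *)
  have h7 : 5000 <= deg H v.
    by apply: leq_trans h6; rewrite /conn_bound (_ : 5000 = 4 * 1250) // leq_mul.
  have h8 : 200 * (deg EA v + deg EB v + deg C v) <= deg H v.
    by rewrite -(@leq_pmul2l 5) // mulnA.
  move: h1 h2 h3 h4 h7 h8; move: #|_| (deg (EA :|: EB :|: C) v) (deg (EA :|: EB) v).
  by move: (deg H v) (deg R v) (deg EA v) (deg EB v) (deg C v); clear; move=> *; lia.
have hfb j : size (fb j) <= 3 by case: j.
have [w [ts [tj [[zs ws ns n3s] [zj fj]]]]] := specials_and_tails bR hfb cap.
set U := _ ++ _ => -[uU aU].
have UH E : E \in U -> E \in H /\ E \notin EA :|: EB :|: C.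
  by move/(allP aU); rewrite /= inE => /andP[].
pose M0 := H :\: [set E in U].
pose root x := if x \in A then rA else rB.
pose ch (s : I -> bool) i := [set (if s i then (V i).2 else (V i).1.1); (V i).1.2].
have chV s i : ch s i \in visit_edges (V i).
  by rewrite /ch !inE; case: (s i); rewrite ?eqxx // setUC eqxx orbT.
have inj s : injective (ch s).
  move=> i j e; apply: (flatten_uniq_inj uV) (mem_enum _ i) (mem_enum _ j) (chV s i) _.
  by rewrite e chV.
have chAB s i : ch s i \in EA :|: EB by apply: (allP (aV i)); apply: chV.
have chM0 s i : ch s i \in M0.
  rewrite inE (subsetP sAB _ (chAB s i)) andbT inE; apply/negP=> /UH[_].
  by rewrite in_setU chAB.
have sep i : (V i).1.1 != (V i).1.2 /\ (V i).2 != (V i).1.2.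
  have := hV i; rewrite mem_cat => /orP[/hVA|/hVB] [h1 h2 h3].
    by split=> //; [apply: contraTneq h1|apply: contraTneq h3] => ->.
  by split=> //; [apply: contraTneq h1|apply: contraTneq h3] => ->.
have hroot x : connect (fun a b => [exists i, ((V i).1.1 == a) && ((V i).2 == b)]) (root x) x.
  have lift VV : {subset VV <= W} -> subrel (links VV)
      (fun a b => [exists i, ((V i).1.1 == a) && ((V i).2 == b)]).
    move=> sV a b /hasP[t /sV tW h]; have /tnthP[i ei] : t \in in_tuple W by [].
    by apply/existsP; exists i; rewrite /V -ei.
  have cs VV y : {subset VV <= W} -> connect (links VV) y x ->
      connect (fun a b => [exists i, ((V i).1.1 == a) && ((V i).2 == b)]) y x.
    by move=> sV; apply: connect_sub => a b /(lift _ sV) h; apply: connect1.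
  rewrite /root; case: ifPn => xA.
    by apply: cs (lVA x xA) => t tV; rewrite mem_cat tV.
  by apply: cs (lVB x _) => [t tV|]; rewrite ?mem_cat ?tV ?orbT ?inE.
have [s hs] := parity_choice (fun i => proj1 (sep i)) (fun i => proj2 (sep i)) inj chM0 hroot.
(* Left for the Euler trail are C, the other edge of each visit, and the reserved edges that no tail
   or special path has taken. *)
pose M := M0 :\: [set ch s i | i : I].
have sM0 : M0 \subset H by apply: subsetDl.
have sMH : M \subset H by apply: subset_trans (subsetDl _ _) sM0.
have bM := bip_sub sMH bH; have sM := bip_simple bM.
have pH : perm_eq (U ++ [seq ch s i | i <- enum I] ++ enum M) (enum H).
  apply: uniq_perm; rewrite ?enum_uniq //.
    rewrite cat_uniq uU cat_uniq !enum_uniq (map_inj_uniq (inj s)) enum_uniq has_cat negb_or andbT.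
    apply/and3P; split; first (by []); first (apply/andP; split); apply/hasPn=> E.
    - by case/mapP=> i _ ->; have := chM0 s i; rewrite !inE => /andP[].
    - by rewrite mem_enum !inE => /and3P[].
    rewrite mem_enum 2!inE => /andP[h _]; apply: contra h => /mapP[i _ ->].
    exact: imset_f.
  move=> E; rewrite mem_cat [X in _ || X]mem_cat !mem_enum; apply/or3P/idP => [[/UH[h _] //|/mapP[i _ ->]|]|EH].
  - exact: (subsetP sM0 _ (chM0 s i)).
  - exact: (subsetP sMH).
  have [EU|nEU] := boolP (E \in U); first by constructor 1.
  have [hC|nC] := boolP (E \in [set ch s i | i : I]).
    by constructor 2; case/imsetP: hC => i _ ->; apply: map_f; rewrite mem_enum.
  by constructor 3; rewrite inE nC !inE nEU.
have szO : #|{: {o | o \in O}}| = #|O| by rewrite card_sig; apply: eq_card.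
have szT : size U = 2 * #|T| + (4 * (2 * #|T|) + 4 * (size W + #|O|)).
  have te x p : size p = 4 -> size (tedges x p) = 4 by rewrite size_tedges.
  rewrite /U !size_cat (@size_flatten_map _ _ _ 4) => [|i]; last by rewrite te.
  rewrite (@size_flatten_map _ _ _ 4) => [|i]; last by rewrite te.
  have cJ : #|J| = size W + #|O| by rewrite /J card_sum card_ord szO.
  by rewrite size_map -!cardE cJ card_prod card_bool -size_cat.
(* Outside M, each visit, special path and element of O accounts for five edges. *)
have d5M : 5 %| #|M|.
  have szM : size ([seq ch s i | i <- enum I] ++ enum M) = size W + #|M|.
    by rewrite [LHS]size_cat size_map -!cardE card_ord.
  have := perm_size pH; rewrite size_cat szT szM -cardE.
  move: d5; move: #|O| #|H| #|M| #|T| (size W) => a b c d f; clear; move=> h1 h2; lia.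
have cM : connected_edges M.
  move=> x y; apply: conn_subset (cC x y); apply/subsetP=> E EC.
  rewrite !inE (subsetP sC _ EC) andbT; apply/andP; split.
    apply/negP=> /imsetP[i _ eE]; have := chAB s i; rewrite -eE inE => /orP[].
      by move=> EE; rewrite (disjointFr dAC EE) in EC.
    by move=> EE; rewrite (disjointFr dBC EE) in EC.
  by apply/negP=> /UH[_]; rewrite !inE EC orbT.
have evM v : v != rA -> v != rB -> ~~ odd (deg M v).
  move=> nA nB; apply: hs => x; rewrite /root eq_sym.
  by case: (x \in A).
have oA : odd (deg M rA) = odd #|M|.
  by apply: (odd_side bM rAA) => v vA nv; apply: evM => //; apply: contraNneq rBA => <-.
have oB : odd (deg M rB) = odd #|M|.
  apply: (odd_side (bipC bM) rBC) => v; rewrite inE => vA nv; apply: evM => //.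
  by apply: contraNneq vA => ->.
have nAB : rA != rB by apply: contraNneq rBA => <-.
have [x [p pM]] : exists x p, perm_eq (tedges x p) (enum M).
  (* For odd |M| both roots are odd and the trail runs from rA to rB; otherwise all degrees are even
     and it is a tour. *)
  case oM : (odd #|M|) oA oB => oA oB.
    have [|p [_ pp]] := @euler_trail T M rA rB sM cM; last by exists rA, p.
    move=> v; have [->|nA] := eqVneq v rA; first by rewrite oA (negPf nAB).
    by have [->|nB] := eqVneq v rB; [rewrite oB|rewrite (negPf (evM v nA nB))].
  have [|p [_ pp]] := @euler_trail T M rA rA sM cM; last by exists rA, p.
  move=> v; rewrite addbb; have [->|nA] := eqVneq v rA; first by rewrite oA.
  by have [->|nB] := eqVneq v rB; [rewrite oB|rewrite (negPf (evM v nA nB))].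
have [n hn] : exists n, size p = 5 * n.
  case/dvdnP: d5M => n hn; exists n.
  by rewrite -(size_tedges x) (perm_size pM) -cardE hn mulnC.
have [LM [aLM eLM]] := cut_trail x hn.
pose n3 k v := nth v (ts k v) 2.
have uLM : uniq (end_edges w ++ flatten (map path_edges LM)).
  rewrite eLM cat_uniq (perm_uniq pM) enum_uniq andbT; apply/andP; split.
    by move: uU; rewrite /U cat_uniq => /andP[].
  apply/hasPn=> E; rewrite (perm_mem pM) mem_enum !inE => /and3P[_ nU _].
  by apply: contra nU => h; rewrite /U mem_cat h.
have [w' [L' [pL' hw' gL']]] := @repair T n3 n3s w LM aLM uLM ws.
pose LO := [seq [:: (val o).2, (val o).1 & tj (inr o)] | o <- enum {: {o | o \in O}}].
pose LV := [seq [:: if s i then (V i).2 else (V i).1.1, (V i).1.2 & tj (inl i)] | i <- enum I].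
pose LS := [seq [:: w' i.1 i.2, i.2 & ts i.1 i.2] | i <- enum {: bool * T}].
pose tO := flatten [seq tedges (val o).1 (tj (inr o)) | o <- enum {: {o | o \in O}}].
pose tI := flatten [seq tedges (V i).1.2 (tj (inl i)) | i <- enum I].
pose tS := flatten [seq tedges i.2 (ts i.1 i.2) | i <- enum {: bool * T}].
have pU : perm_eq U (end_edges w ++ tS ++ tI ++ tO).
  rewrite /U !perm_cat2l.
  apply: perm_trans (perm_flatten (perm_map _ (perm_enum_sum I {o | o \in O}))) _.
  by rewrite map_cat flatten_cat /tI /tO -!map_comp.
have pLV : perm_eq (flatten (map path_edges LV)) ([seq ch s i | i <- enum I] ++ tI).
  by rewrite -map_comp; apply: perm_flatten_cons.
have pLS : perm_eq (flatten (map path_edges LS)) (end_edges w' ++ tS).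
  by rewrite -map_comp; apply: perm_flatten_cons.
have pLO : perm_eq (flatten (map path_edges LO)) ([seq [set o.1; o.2] | o <- enum O] ++ tO).
  rewrite -map_comp; apply: perm_trans (perm_flatten_cons _ _ _) _; rewrite perm_cat2r.
  have pO : perm_eq [seq val o | o <- enum {: {o | o \in O}}] (enum O).
    apply: uniq_perm; rewrite ?enum_uniq ?(map_inj_uniq val_inj) ?enum_uniq // => o.
    rewrite mem_enum; apply/mapP/idP => [[o' _ ->]|oO]; first exact: valP.
    by exists (Sub o oO); rewrite ?mem_enum ?SubK.
  have := perm_map (fun o : T * T => [set o.1; o.2]) pO; rewrite -map_comp => h.
  by rewrite -(permPr h); apply/permP=> q; congr (count q _); apply: eq_map => o /=; rewrite setUC.
(* The paths through O are kept apart: only their tails [tO] lie in H. *)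
have pG : perm_eq (flatten (map path_edges (LV ++ LS ++ L')) ++ tO) (enum H).
  apply/permP=> q; rewrite -(permP pH) [in RHS]count_cat (permP pU) !map_cat !flatten_cat !count_cat (permP pLV) (permP pLS).
  move/permP/(_ q): pL'; rewrite eLM !count_cat (permP pM); clear=> h; lia.
exists (LO ++ LV ++ LS ++ L'); split; last first.
  apply/permP=> q; rewrite map_cat flatten_cat !count_cat (permP pLO) count_cat.
  by have := permP pG q; rewrite count_cat; clear=> h; lia.
rewrite all_cat; apply/andP; split.
  apply/allP=> t /mapP[o _ ->]; have bO := nO _ (valP o).
  have tU E : E \in tedges (st (inr o)) (tj (inr o)) -> E \in U.
    move=> hE; rewrite (perm_mem pU) !mem_cat; apply/orP; right; apply/orP; right; apply/orP; right.
    by apply/flatten_mapP; exists o; rewrite ?mem_enum.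
  apply: (uniq_cons2 bH) => //; first by apply/allP=> E /tU/UH[].
    move: uU; rewrite (perm_uniq pU) !cat_uniq => /and3P[_ _ /and3P[_ _ /and3P[_ _]]] /uniq_flatten_mem; apply.
    by apply: map_f; rewrite mem_enum.
  exact: (fj (inr o)).
have uG := enum_uniq H; rewrite -(perm_uniq pG) cat_uniq in uG.
have {uG} /andP[uG _] := uG.
apply/allP=> t tL; apply: (uniq_good bH).
- move: tL; rewrite !mem_cat => /or3P[/mapP[i _ ->]|/mapP[i _ ->]|/(allP gL')//].
    have nf k : k < 4 -> nth (V i).1.2 (tj (inl i)) k \notin fb (inl i).
      by move=> hk; apply: (allP (fj (inl i))); rewrite mem_nth ?zj.
    apply: good_cons2; first exact: zj.
      have := nf 2 isT; rewrite !inE !negb_or => /and3P[h1 h2 h3].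
      by rewrite eq_sym; case: (s i).
    by have := nf 3 isT; rewrite !inE !negb_or => /and3P[h1 h2 h3]; rewrite eq_sym.
  by apply: good_cons2; [exact: zs|exact: hw'|exact: ns].
- apply/allP=> E Et; rewrite /= -mem_enum -(perm_mem pG) mem_cat; apply/orP; left.
  by apply/flatten_mapP; exists t.
by apply: uniq_flatten_mem uG _; apply: map_f.
Qed.

End Assembly.

(** * Reduction to the bipartite part *)

Section MaxCut.
Variable T : finType.
Implicit Types (A S : {set T}) (X H : {set {set T}}) (e g : rel T).

Lemma in_edges e x y : symmetric e -> ([set x; y] \in edges e) = e x y.
Proof.
move=> sym; apply/imsetP/idP => [[[u v] h /set2_eqP]|h]; last by exists (x, y).
by move: h; rewrite inE /= => h [[-> ->]|[-> ->]] //; rewrite sym.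
Qed.

Lemma edgesP e E : E \in edges e -> exists x y, e x y /\ E = [set x; y].
Proof. by case/imsetP=> -[x y] h ->; exists x, y. Qed.

Lemma in_cut X S x y : [set x; y] \in X -> ([set x; y] \in cut X S) = (x \in S) (+) (y \in S).
Proof.
move=> XE; rewrite inE XE subUset !sub1set negb_and /=.
have -> : ([set x; y] :&: S != set0) = (x \in S) || (y \in S).
  apply/set0Pn/orP => [[z]|[h|h]]; last 2 first.
  - by exists x; rewrite !inE eqxx.
  - by exists y; rewrite !inE eqxx orbT.
  by rewrite !inE => /andP[/orP[/eqP ->|/eqP ->]]; [left|right].
by case: (x \in S); case: (y \in S).
Qed.

(** Replacing A by its symmetric difference with S exchanges cut and uncut edges among those leaving
    S and affects no others. By maximality at least half of the edges leaving S belong to the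
    cut. *)
Lemma max_cut e k : symmetric e -> k_edge_connected (2 * k) e ->
  exists A, bip A (cut (edges e) A) /\
    forall S, S != set0 -> S != setT -> k <= #|cut (cut (edges e) A) S|.
Proof.
move=> sym kc.
case: (@arg_maxnP _ set0 xpredT (fun A : {set T} => #|cut (edges e) A|) isT) => A _ maxA.
exists A; split=> [E EH|S S0 ST].
  have EX : E \in edges e by move: EH; rewrite inE => /andP[].
  have [x [y [exy eE]]] := edgesP EX; rewrite eE in EH EX *.
  move: EH; rewrite in_cut //; case: (boolP (x \in A)) => xA; case: (boolP (y \in A)) => yA //= _.
    by exists x, y.
  by exists y, x; rewrite setUC.
have kS : 2 * k <= #|cut (edges e) S|.
  rewrite leqNgt; apply/negP=> lt; have /set0Pn[x xS] := S0.
  have /subsetPn[y _ yS] : ~~ ([set: T] \subset S) by rewrite subTset.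
  have sub : cut (edges e) S \subset edges e by apply/subsetP=> E; rewrite inE => /andP[].
  have [u [z [uS zS]]] := conn_exit (S := mem S) (kc _ sub lt x y) xS yS.
  rewrite inE => /andP[nc ec]; move: nc; rewrite in_cut //.
  by move: uS zS => /= -> /negPf ->.
pose A' := (A :\: S) :|: (S :\: A).
have mA := maxA A' isT.
have eA' : cut (edges e) A' = (cut (edges e) A :\: cut (edges e) S) :|: (cut (edges e) S :\: cut (edges e) A).
  apply/setP=> E; have [EX|nE] := boolP (E \in edges e); last by rewrite !inE (negPf nE) ?andbF.
  have [x [y [exy eE]]] := edgesP EX; rewrite eE in EX *.
  rewrite in_setU !in_setD !in_cut // !inE.
  by case: (x \in A); case: (x \in S); case: (y \in A); case: (y \in S).
have d0 : [disjoint cut (edges e) A :\: cut (edges e) S & cut (edges e) S :\: cut (edges e) A].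
  rewrite -setI_eq0; apply/eqP/setP=> E; rewrite in_setI !in_setD [RHS]inE.
  by case: (E \in cut _ A); rewrite ?andbF.
have h1 : #|cut (edges e) A'| = #|cut (edges e) A :\: cut (edges e) S| + #|cut (edges e) S :\: cut (edges e) A|.
  by rewrite eA'; apply/eqP; rewrite (leq_card_setU _ _).2.
have h2 := cardsID (cut (edges e) S) (cut (edges e) A).
have h3 := cardsID (cut (edges e) A) (cut (edges e) S).
have -> : cut (cut (edges e) A) S = cut (edges e) A :&: cut (edges e) S.
  apply/setP=> E; rewrite [LHS]inE in_setI [E \in cut _ S]inE; case: (boolP (E \in cut _ A)) => //=.
  by rewrite inE => /andP[-> _].
have h4 : #|cut (edges e) S :&: cut (edges e) A| = #|cut (edges e) A :&: cut (edges e) S| by rewrite setIC.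
move: kS mA h1 h2 h3 h4; rewrite -/A'.
move: #|cut (edges e) A'| #|cut (edges e) S| #|cut (edges e) A| => a b c.
move: #|_| #|_| #|_| #|_| => p q r t; clear; lia.
Qed.

End MaxCut.

Theorem mainTheorem8 :
  exists k : nat, forall (T : finType) (e : rel T),
    symmetric e -> irreflexive e -> k_edge_connected k e ->
    5 %| #|edges e| -> P5_decomposable e.
Proof.
(* The factor 2 is lost in passing to the maximum cut. *)
exists (2 * conn_bound) => T e sym irr kc d5.
have [T1|T2] := leqP #|T| 1.
  apply: (@P5_decomposable_of_list T e [::]) => //=.
  apply: uniq_perm; rewrite ?enum_uniq // => E; rewrite mem_enum; apply/esym/negbTE/negP.
  case/edgesP=> x [y [exy _]]; have exy' : x = y := fintype_le1P T1 y x.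
  by rewrite exy' irr in exy.
have [A [bH hcut]] := max_cut sym kc; set H := cut _ A in bH hcut.
pose g : rel T := fun x y => e x y && ((x \in A) == (y \in A)).
have symg : symmetric g by move=> x y; rewrite /g sym eq_sym.
have [L0 [aL0 uL0 eL0 free]] := maximal_P5_packing symg.
set f := (fun x y => _) in free.
have symf : symmetric f by move=> x y; rewrite /f symg setUC.
have irf : irreflexive f by move=> x; rewrite /f /g irr.
have [O [hO Of dO]] := degenerate_orientation symf irf free.
have nO : {in O, forall o, o.1 != o.2}.
  by move=> [x y] /Of; apply: contraTneq => /= ->; rewrite irf.
have pE : perm_eq (enum (edges e))
    (flatten (map path_edges L0) ++ [seq [set o.1; o.2] | o <- enum O] ++ enum H).
  have OE o : o \in O -> f o.1 o.2 by case: o => x y /Of.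
  have HA x y : [set x; y] \in H -> (x \in A) != (y \in A).
    by move=> h; rewrite (bip_side bH h); case: (x \in A).
  apply: uniq_perm; first exact: enum_uniq.
    rewrite !cat_uniq uL0 enum_uniq andbT has_cat negb_or /=; apply/and3P; split.
    - apply/andP; split; apply/hasPn=> E.
        by case/mapP=> o; rewrite mem_enum => /OE/andP[_ ?] ->.
      rewrite mem_enum => EH; apply/negP=> /(allP eL0)/edgesP[x [y [/andP[_ s] eE]]].
      by rewrite eE in EH; move: (HA _ _ EH); rewrite s.
    - rewrite map_inj_in_uniq ?enum_uniq // => -[x y] [x' y']; rewrite !mem_enum => h h' /set2_eqP /=.
      case=> [[-> ->] //|[e1 e2]]; have := hO x y (OE _ h).
      by rewrite h e1 e2 h'.
    apply/hasPn=> E; rewrite mem_enum => EH; apply/mapP=> -[o]; rewrite mem_enum => /OE.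
    by case/andP=> /andP[_ s] _ eE; rewrite eE in EH; move: (HA _ _ EH); rewrite s.
  move=> E; rewrite !mem_cat !mem_enum; apply/idP/or3P.
    case/edgesP=> x [y [exy ->]].
    case: (boolP ([set x; y] \in flatten (map path_edges L0))) => [?|nL0]; first by constructor 1.
    case: (boolP ((x \in A) == (y \in A))) => s; last first.
      constructor 3; rewrite in_cut ?in_edges //.
      by case: (x \in A) s; case: (y \in A).
    have fxy : f x y by rewrite /f /g exy s.
    constructor 2; have := hO x y fxy; case xyO : ((x, y) \in O) => /= yxO.
      by apply/mapP; exists (x, y); rewrite ?mem_enum.
    by apply/mapP; exists (y, x); rewrite ?mem_enum //= setUC.
  case=> [/(allP eL0)/edgesP[x [y [/andP[h _] ->]]]|/mapP[o]|].
  - by rewrite in_edges.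
  - by rewrite mem_enum => /OE/andP[/andP[h _] _] ->; rewrite in_edges.
  by rewrite inE => /andP[].
have d5' : 5 %| #|O| + #|H|.
  (* The paths already removed inside the sides use a multiple of five edges, so divisibility passes
     to O and H together. *)
  have := perm_size pE; rewrite !size_cat size_map -!cardE => sz.
  have [n hn] : exists n, size (flatten (map path_edges L0)) = 5 * n.
    elim: (L0) aL0 => [|t L IH] /=; first by exists 0.
    case/andP=> /andP[_ /eqP st] /IH[n hn]; exists n.+1; rewrite size_cat hn.
    by case: t st => [//|x p] [sp]; rewrite /= size_tedges sp; lia.
  by move: d5; rewrite sz hn dvdn_addr // dvdn_mulr.
have [L [aL pL]] := bipartite_part T2 bH hcut nO dO d5'.
apply: (@P5_decomposable_of_list T e (L0 ++ L)); first by rewrite all_cat aL0.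
by rewrite map_cat flatten_cat (permPr pE) perm_cat2l.
Qed.
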